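(* Let $d<\infty$ and let $V,W\subset\mathbb{B}_d$ be analytic discs attached to the unit sphere with embedding maps $f$ and $g$ respectively. If $\mathcal{M}_f$ and $\mathcal{M}_g$ are isomorphic as algebras, then there exists an automorphism $\mu$ of the unit disc $\mathbb{D}$ such that $\mathcal{M}_f=\mathcal{M}_{g\circ\mu}$ with equivalent norms.
   Context: $\mathbb{D}$ is the open unit disc, $\mathbb{T}$ the unit circle, $\mathbb{B}_d$ the open Euclidean unit ball of $\mathbb{C}^d$. The Drury–Arveson space $H^2_d$ is the reproducing kernel Hilbert space on $\mathbb{B}_d$ with kernel $1/(1-\langle z,w\rangle)$, and $\mathcal{M}_d$ denotes its multiplier algebra. A variety is a subset of $\mathbb{B}_d$ which is the common zero set of some family of functions from $\mathcal{M}_d$. An analytic disc attached to the unit sphere is a variety $V\subset\mathbb{B}_d$ ($d<\infty$) for which there is an injective analytic map $f:\mathbb{D}\to\mathbb{B}_d$ with $f'(z)\neq0$ for all $z\in\mathbb{D}$, $V=f(\mathbb{D})$, $f$ extends to a $C^2$ map on $\overline{\mathbb{D}}$, and for $x\in\overline{\mathbb{D}}$, $\|f(x)\|=1$ iff $|x|=1$; such $f$ is called an embedding map of $V$. For a map $h:\mathbb{D}\to\mathbb{B}_d$ (in particular $h=f$ or $h=g\circ\mu$), $\mathcal{H}_h$ is the reproducing kernel Hilbert space on $\mathbb{D}$ with kernel $k^h(z,w)=1/(1-\langle h(z),h(w)\rangle)$, and $\mathcal{M}_h$ is its multiplier algebra; for an embedding map $f$, equivalently $\mathcal{M}_f=\{\varphi\circ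 f:\varphi\in\mathcal{M}_d\}$ with the quotient norm. *)

(* Defs.v *)
From Stdlib Require Import Reals Lra.
From Coquelicot Require Import Coquelicot.
Open Scope R_scope.

(** Index set {0,...,d-1}; the proof component is a boolean equation,
    hence proof-irrelevant, so ('Idx d -> C) is a faithful model of C^d. *)
Definition Idx (d : nat) : Type := {i : nat | Nat.ltb i d = true}.

Definition Cvec (d : nat) : Type := Idx d -> C.

Fixpoint csum (n : nat) (a : nat -> C) : C :=
  match n with
  | O => RtoC 0
  | S m => Cplus (csum m a) (a m)
  end.

Definition isum (d : nat) (a : Idx d -> C) : C :=
  csum d (fun i =>
    match Nat.ltb i d as b return Nat.ltb i d = b -> C with
    | true => fun H => a (exist _ i H)
    | false => fun _ => RtoC 0
    end eq_refl).

Definition cinner (d : nat) (z w : Cvec d) : C :=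
  isum d (fun i => Cmult (z i) (Cconj (w i))).
Definition vnorm (d : nat) (z : Cvec d) : R := sqrt (fst (cinner d z z)).

Definition Ball (d : nat) (z : Cvec d) : Prop := vnorm d z < 1.
Definition Disc (z : C) : Prop := Cmod z < 1.
Definition CDisc (z : C) : Prop := Cmod z <= 1.

Definition PosKernel {X : Type} (S : X -> Prop) (K : X -> X -> C) : Prop :=
  forall (n : nat) (x : nat -> X) (c : nat -> C),
    (forall i, (i < n)%nat -> S (x i)) ->
    let s := csum n (fun i => csum n (fun j =>
               Cmult (Cmult (Cconj (c i)) (c j)) (K (x i) (x j)))) in
    snd s = 0 /\ 0 <= fst s.

(** Norm in the reproducing kernel Hilbert space H(K) on S (Aronszajn):
    h belongs to H(K) with ||h|| <= r  iff  r^2 K(x,y) - h(x) conj(h(y))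
    is a positive kernel on S. *)
Definition HNormLe {X : Type} (S : X -> Prop) (K : X -> X -> C)
  (h : X -> C) (r : R) : Prop :=
  0 <= r /\
  PosKernel S (fun x y => Cminus (Cmult (RtoC (r * r)) (K x y))
                                  (Cmult (h x) (Cconj (h y)))).

Definition MultNormLe {X : Type} (S : X -> Prop) (K : X -> X -> C)
  (phi : X -> C) (M : R) : Prop :=
  0 <= M /\
  forall (h : X -> C) (r : R), HNormLe S K h r ->
    HNormLe S K (fun x => Cmult (phi x) (h x)) (M * r).

Definition IsMult {X : Type} (S : X -> Prop) (K : X -> X -> C)
  (phi : X -> C) : Prop :=
  exists M, MultNormLe S K phi M.

Definition DAker (d : nat) (z w : Cvec d) : C :=
  Cinv (Cminus (RtoC 1) (cinner d z w)).

(** Kernel k^h(z,w) = 1/(1 - <h(z),h(w)>) on D; M_h = IsMult Disc (kerOf d h). *)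
Definition kerOf (d : nat) (h : C -> Cvec d) (z w : C) : C :=
  Cinv (Cminus (RtoC 1) (cinner d (h z) (h w))).

Definition IsVariety (d : nat) (V : Cvec d -> Prop) : Prop :=
  (forall z, V z -> Ball d z) /\
  exists F : (Cvec d -> C) -> Prop,
    (forall phi, F phi -> IsMult (Ball d) (DAker d) phi) /\
    (forall z, Ball d z -> (V z <-> forall phi, F phi -> phi z = RtoC 0)).

Definition CDeriv (f : C -> C) (z l : C) : Prop :=
  @is_derive C_AbsRing C_NormedModule f z l.

Definition C1_on (U : R -> R -> Prop) (g gx gy : R -> R -> R) : Prop :=
  forall x y, U x y ->
    is_derive (fun t => g t y) x (gx x y) /\
    is_derive (fun t => g x t) y (gy x y) /\
    continuity_2d_pt gx x y /\ continuity_2d_pt gy x y.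

Definition C2_on (U : R -> R -> Prop) (g : R -> R -> R) : Prop :=
  exists gx gy, C1_on U g gx gy /\
    (exists gxx gxy, C1_on U gx gxx gxy) /\
    (exists gyx gyy, C1_on U gy gyx gyy).

Definition open2 (U : R -> R -> Prop) : Prop :=
  forall x y, U x y -> exists e, 0 < e /\
    forall x' y', Rabs (x' - x) < e -> Rabs (y' - y) < e -> U x' y'.

Definition imgDisc (d : nat) (f : C -> Cvec d) (z : Cvec d) : Prop :=
  exists x, Disc x /\ f x = z.

(** f : D -> B_d is an embedding map of the analytic disc V = f(D)
    attached to the unit sphere. Only the values of f on D matter; the
    extension to the closed disc is the map F. *)
Definition EmbeddingMap (d : nat) (f : C -> Cvec d) : Prop :=
  IsVariety d (imgDisc d f) /\
  (forall x, Disc x -> Ball d (f x)) /\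
  (forall x y, Disc x -> Disc y -> f x = f y -> x = y) /\
  (exists df : C -> Cvec d,
     (forall x i, Disc x -> CDeriv (fun w => f w i) x (df x i)) /\
     (forall x, Disc x -> exists i, df x i <> RtoC 0)) /\
  (* f extends to a C^2 map F on the closed disc (i.e. the restriction of a
     C^2 map on an open neighbourhood of the closed disc), and for x in the
     closed disc, ||F x|| = 1 iff |x| = 1 *)
  (exists (F : C -> Cvec d) (U : R -> R -> Prop),
     open2 U /\
     (forall x, CDisc x -> U (fst x) (snd x)) /\
     (forall i, C2_on U (fun a b => fst (F (a, b) i))) /\
     (forall i, C2_on U (fun a b => snd (F (a, b) i))) /\
     (forall x, Disc x -> F x = f x) /\
     (forall x, CDisc x -> (vnorm d (F x) = 1 <-> Cmod x = 1))).

Definition DiscAut (mu : C -> C) : Prop :=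
  (forall z, Disc z -> Disc (mu z)) /\
  (forall z, Disc z -> exists l, CDeriv mu z l) /\
  exists nu : C -> C,
    (forall z, Disc z -> Disc (nu z)) /\
    (forall z, Disc z -> exists l, CDeriv nu z l) /\
    (forall z, Disc z -> nu (mu z) = z) /\
    (forall z, Disc z -> mu (nu z) = z).

Definition eqD (p q : C -> C) : Prop := forall z, Disc z -> p z = q z.

(** Algebra isomorphism between Mult(H(K1)) and Mult(H(K2)), both algebras of
    functions on D (elements identified when equal on D). *)
Definition MultAlgIso (K1 K2 : C -> C -> C) : Prop :=
  exists Phi : (C -> C) -> (C -> C),
    (forall p, IsMult Disc K1 p -> IsMult Disc K2 (Phi p)) /\
    (forall p q, IsMult Disc K1 p -> IsMult Disc K1 q -> eqD p q ->
       eqD (Phi p) (Phi q)) /\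
    (forall (a : C) p q, IsMult Disc K1 p -> IsMult Disc K1 q ->
       eqD (Phi (fun z => Cplus (Cmult a (p z)) (q z)))
           (fun z => Cplus (Cmult a (Phi p z)) (Phi q z))) /\
    (forall p q, IsMult Disc K1 p -> IsMult Disc K1 q ->
       eqD (Phi (fun z => Cmult (p z) (q z)))
           (fun z => Cmult (Phi p z) (Phi q z))) /\
    (forall p q, IsMult Disc K1 p -> IsMult Disc K1 q ->
       eqD (Phi p) (Phi q) -> eqD p q) /\
    (forall r, IsMult Disc K2 r -> exists p, IsMult Disc K1 p /\ eqD (Phi p) r).

(* Main.v *)
(** For an embedding map [f] write k^f for its kernel; phi is a multiplier of norm at most M iff
    (M^2 - phi phi^* ) k^f >= 0.  The kernel has the complete Pick property, so a lurking isometry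
    argument on finite sets, followed by a compactness argument, yields Leech's factorization and
    hence a solution of Gleason's problem with multiplier coefficients:
    phi - phi(x0) = sum_i (f_i - f_i(x0)) psi_i.

    Let Phi be the isomorphism and fix a point y of the disc.  The character p |-> Phi(p)(y) is
    contractive by a Neumann-type resolvent estimate, so G(y) = (Phi(f_i)(y))_i lies in the closed
    ball.  A gliding hump shows that Phi is bounded; if |G(y)| = 1, then p = Phi(<f, G(y)>) is
    power bounded with p(y) = 1, its Cesaro means force p = 1 by connectedness, and <f, G(y)> is
    constant of modulus one, which is absurd.  Gleason's decomposition on the points of V together
    with G(y), applied to a multiplier that vanishes on V, shows that G(y) belongs to V, and applied
    at the corresponding point nu(y) it shows that Phi(p)(y) = p(nu(y)) for every p.

    The same holds for the inverse of Phi, so nu is bijective.  It is continuous because f is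
    proper, and holomorphic because f_i o nu = Phi(f_i) is holomorphic (again by Gleason's
    decomposition) while f' has no zero.  Then mu is the inverse of nu, and boundedness of Phi and
    of its inverse gives the equivalence of norms. *)
Require Import Defs.
From Stdlib Require Import Reals Lra ClassicalEpsilon FunctionalExtensionality.
From Coquelicot Require Import Coquelicot.
Open Scope R_scope.

(** * Real analysis on the disc *)

(** The obstacle is the sphere: a character whose coordinates lie there need not, a priori, be a
    point evaluation, and Gleason's problem is solved only at centres in the open ball, with a
    constant that degenerates towards the sphere. This explains the detour through boundedness.
    Contractivity of single characters bounds [T p] only pointwise; that is just enough to make the
    suprema in the gliding hump finite, and the resulting bound in multiplier norm gives all Cesaro
    means one common Lipschitz constant. Multipliers are treated on an arbitrary set with a map [b]
    into a ball. The same results then serve finite index sets, the disc, and the disc with one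
    extra point. Norms enter only through kernel inequalities, so sums, resolvents and limits are
    handled by explicit positive combinations, and no Hilbert space has to be formed. *)

Lemma CDerivE (f : C -> C) (z l : C) : CDeriv f z l <->
  forall eps, 0 < eps -> exists delta, 0 < delta /\ forall y, Cmod (y - z)%C < delta ->
    Cmod (f y - f z - (y - z) * l)%C <= eps * Cmod (y - z)%C.
Proof.
  split.
  - intros [_ H] eps Heps.
    destruct (H z (fun P HP => HP) (mkposreal eps Heps)) as [delta Hd].
    exists delta; split; [apply cond_pos|].
    intros y Hy; exact (Hd y Hy).
  - intros H; split.
    + apply is_linear_scal_l.
    + intros x Hx.
      rewrite <- (@is_filter_lim_locally_unique C_AbsRing (AbsRing_NormedModule C_AbsRing) z x Hx).
      intros eps; destruct (H eps (cond_pos eps)) as [delta [Hd HD]].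
      exists (mkposreal delta Hd); intros y Hy; exact (HD y Hy).
Qed.

Lemma Cmod_le_coords (z : C) : Cmod z <= Rabs (fst z) + Rabs (snd z).
Proof.
  destruct z as [a b]; unfold Cmod; simpl fst; simpl snd.
  rewrite <- (sqrt_Rsqr (Rabs a + Rabs b)) by (pose proof (Rabs_pos a); pose proof (Rabs_pos b); lra).
  apply sqrt_le_1_alt; unfold Rsqr; simpl.
  pose proof (Rsqr_abs a) as Ha; pose proof (Rsqr_abs b) as Hb; unfold Rsqr in Ha, Hb.
  pose proof (Rabs_pos a); pose proof (Rabs_pos b); nra.
Qed.

Lemma Cmod_coord_le (z : C) : Rabs (fst z) <= Cmod z /\ Rabs (snd z) <= Cmod z.
Proof.
  pose proof (Rmax_Cmod z); pose proof (Rmax_l (Rabs (fst z)) (Rabs (snd z)));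
  pose proof (Rmax_r (Rabs (fst z)) (Rabs (snd z))); lra.
Qed.

(** [C2_on] speaks only of partial derivatives; continuity of [gx] turns them into joint
    differentiability, and hence into joint continuity. *)
Lemma C2_continuity (U : R -> R -> Prop) (g : R -> R -> R) (x y : R) :
  open2 U -> U x y -> C2_on U g -> continuity_2d_pt g x y.
Proof.
  intros HU Uxy [gx [gy [H1 _]]].
  destruct (H1 x y Uxy) as [_ [Hy [Hcx _]]].
  apply continuity_2d_pt_filterlim.
  apply (filterdiff_continuous (fun u : R * R => g (fst u) (snd u))).
  eexists; apply (is_derive_filterdiff g x y gx (gy x y)).
  - destruct (HU x y Uxy) as [e [He HE]].
    exists (mkposreal e He); intros [u v] [Hu Hv].
    destruct (H1 u v) as [Hd _]; [apply HE; assumption | exact Hd].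
  - exact Hy.
  - apply (continuity_2d_pt_filterlim gx x y), Hcx.
Qed.

(** This is continuity of the inverse of f at f(y0). Points staying away from y0 accumulate in the
    closed disc, where injectivity (inside) or the norm of [F] (on the circle) separates their
    images from f(y0). *)
Lemma embedding_proper (d : nat) (f : C -> Cvec d) (y0 : C) (e : R) :
  EmbeddingMap d f -> Disc y0 -> 0 < e ->
  exists eta, 0 < eta /\ forall x, Disc x ->
    (forall i, Cmod (f x i - f y0 i)%C < eta) -> Cmod (x - y0)%C < e.
Proof.
  intros [_ [Hball [Hinj [_ [F [U [HU [HCU [H1 [H2 [HF Hbd]]]]]]]]]]] Dy He.
  (* A local gauge at each (u, v): at y0 the condition [e <= Cmod (x - y0)] fails nearby, at any
     other point of the closed disc a coordinate of [F] separates, and off the closed disc there is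
     no nearby x in the disc. *)
  assert (Hloc : forall u v, exists dl : posreal, forall x, Disc x ->
      Rabs (fst x - u) < dl -> Rabs (snd x - v) < dl -> e <= Cmod (x - y0)%C ->
      exists i, dl <= Cmod (f x i - f y0 i)%C).
  { intros u v; pose (w := (u, v) : C).
    assert (Hxw : forall x : C, Cmod (x - w)%C <= Rabs (fst x - u) + Rabs (snd x - v)).
    { intros x; exact (Cmod_le_coords (x - w)%C). }
    destruct (Rle_lt_dec (Cmod w) 1) as [Hw|Hw].
    - destruct (classic (w = y0)) as [E|E].
      + assert (He2 : 0 < e / 2) by lra.
        exists (mkposreal _ He2); simpl; intros x Dx Hu Hv Hx.
        specialize (Hxw x); rewrite E in Hxw; lra.
      + assert (Hne : exists i, F w i <> f y0 i).
        { apply NNPP; intros Hn; apply E.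
          assert (EF : F w = f y0).
          { apply functional_extensionality_dep; intros i.
            apply NNPP; intros Hi; apply Hn; exists i; exact Hi. }
          pose proof (Hball y0 Dy) as Hb; unfold Ball in Hb.
          destruct Hw as [Hw|Hw].
          - apply Hinj; [exact Hw | exact Dy |].
            rewrite <- (HF w Hw); exact EF.
          - assert (vnorm d (F w) = 1) by (apply Hbd; [right; exact Hw | exact Hw]); rewrite EF in *; lra. }
        destruct Hne as [i Hi].
        set (m := Cmod (F w i - f y0 i)%C).
        assert (Hm : 0 < m).
        { apply Cmod_gt_0; intros E0; apply Hi.
          replace (F w i) with ((F w i - f y0 i) + f y0 i)%C by ring.
          rewrite E0; ring. }
        assert (Hm4 : 0 < m / 4) by lra.
        destruct (C2_continuity _ _ u v HU (HCU w Hw) (H1 i) (mkposreal _ Hm4)) as [d1 Hd1].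
        destruct (C2_continuity _ _ u v HU (HCU w Hw) (H2 i) (mkposreal _ Hm4)) as [d2 Hd2].
        simpl in Hd1, Hd2.
        assert (Hd : 0 < Rmin (m / 2) (Rmin d1 d2)).
        { repeat apply Rmin_pos; [lra | apply cond_pos | apply cond_pos]. }
        exists (mkposreal _ Hd); simpl; intros x Dx Hu Hv _; exists i.
        assert (L1 := Rmin_l (m / 2) (Rmin d1 d2)).
        assert (L2 := Rmin_r (m / 2) (Rmin d1 d2)).
        assert (L3 := Rmin_l d1 d2); assert (L4 := Rmin_r d1 d2).
        destruct x as [p q]; simpl in Hu, Hv.
        assert (A1 := Hd1 p q ltac:(lra) ltac:(lra)).
        assert (A2 := Hd2 p q ltac:(lra) ltac:(lra)).
        rewrite (HF (p, q) Dx) in A1, A2.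
        assert (A3 := Cmod_le_coords (f (p, q) i - F w i)%C); simpl in A3.
        assert (A4 := Cmod_triangle (F w i - f (p, q) i)%C (f (p, q) i - f y0 i)%C).
        replace ((F w i - f (p, q) i) + (f (p, q) i - f y0 i))%C with (F w i - f y0 i)%C in A4 by ring.
        replace (F w i - f (p, q) i)%C with (- (f (p, q) i - F w i))%C in A4 by ring.
        rewrite Cmod_opp in A4.
        fold w in A1, A2; fold m in A4.
        unfold Rminus in A1, A2. lra.
    - assert (Hw2 : 0 < (Cmod w - 1) / 2) by lra.
      exists (mkposreal _ Hw2); simpl; intros x Dx Hu Hv _; exfalso.
      specialize (Hxw x).
      assert (A := Cmod_triangle (w - x)%C x).
      replace (w - x + x)%C with w in A by ring.
      replace (w - x)%C with (- (x - w))%C in A by ring.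
      rewrite Cmod_opp in A; unfold Disc in Dx; lra. }
  pose (delta := fun u v => proj1_sig (constructive_indefinite_description _ (Hloc u v))).
  assert (Hdelta : forall u v x, Disc x ->
      Rabs (fst x - u) < delta u v -> Rabs (snd x - v) < delta u v -> e <= Cmod (x - y0)%C ->
      exists i, delta u v <= Cmod (f x i - f y0 i)%C).
  { intros u v; exact (proj2_sig (constructive_indefinite_description _ (Hloc u v))). }
  (* Compactness of the square provides one [eta] below the gauge at some (u, v) whose gauge
     neighbourhood contains x. *)
  destruct (compactness_value_2d (-1) 1 (-1) 1 delta) as [eta Heta].
  exists eta; split; [apply cond_pos|].
  intros x Dx Hx; destruct (Rlt_le_dec (Cmod (x - y0)%C) e) as [|Hge]; [assumption|exfalso].
  destruct (Cmod_coord_le x) as [C1 C2]; unfold Disc in Dx.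
  assert (B1 := Rabs_def2 (fst x) 1 ltac:(lra)); assert (B2 := Rabs_def2 (snd x) 1 ltac:(lra)).
  apply (Heta (fst x) (snd x)); [lra | lra |].
  intros [u [v [_ [_ [Hu [Hv Hd]]]]]].
  destruct (Hdelta u v x Dx Hu Hv Hge) as [i Hi].
  specialize (Hx i); lra.
Qed.

(** On the segment from x to y the indicator of [P] would be a continuous function with values 0 and
    1 only, against the intermediate value theorem. *)
Lemma disc_connected (P : C -> Prop) :
  (forall x, Disc x -> exists delta, 0 < delta /\
     forall y, Disc y -> Cmod (y - x)%C < delta -> (P y <-> P x)) ->
  forall x y, Disc x -> Disc y -> P x -> P y.
Proof.
  intros Hloc x y Dx Dy Px; apply NNPP; intros nPy.
  (* Clamping the parameter to [0,1] keeps the path in the disc and Lipschitz on the whole line,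
     since [IVT_gen] asks for global continuity. *)
  pose (cl := fun t => Rmax 0 (Rmin 1 t)).
  assert (Hcl : forall t, 0 <= cl t <= 1).
  { intros t; unfold cl; split; [apply Rmax_l|].
    apply Rmax_lub; [lra|apply Rmin_l]. }
  assert (Hlip : forall s t, Rabs (cl s - cl t) <= Rabs (s - t)).
  { intros s t; unfold cl, Rmax, Rmin.
    repeat destruct Rle_dec; unfold Rabs; repeat destruct Rcase_abs; lra. }
  pose (gam := fun t => (RtoC (1 - cl t) * x + RtoC (cl t) * y)%C).
  assert (Dg : forall t, Disc (gam t)).
  { intros t; unfold Disc, gam.
    apply Rle_lt_trans with (1 := Cmod_triangle _ _).
    rewrite 2!Cmod_mult, 2!Cmod_R.
    destruct (Hcl t); rewrite (Rabs_pos_eq (1 - cl t)), (Rabs_pos_eq (cl t)) by lra.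
    unfold Disc in Dx, Dy.
    destruct (Req_dec (cl t) 0) as [E|E]; [rewrite E; lra|].
    assert (0 < cl t) by lra.
    apply Rlt_le_trans with ((1 - cl t) * 1 + cl t * 1); [|lra].
    apply Rplus_le_lt_compat; [apply Rmult_le_compat_l; lra | apply Rmult_lt_compat_l; lra]. }
  assert (Hg : forall s t, Cmod (gam s - gam t)%C <= Rabs (s - t) * Cmod (y - x)%C).
  { intros s t; unfold gam.
    replace (RtoC (1 - cl s) * x + RtoC (cl s) * y - (RtoC (1 - cl t) * x + RtoC (cl t) * y))%C
      with (RtoC (cl s - cl t) * (y - x))%C by (rewrite !RtoC_minus; ring).
    rewrite Cmod_mult, Cmod_R; apply Rmult_le_compat_r; [apply Cmod_ge_0|apply Hlip]. }
  pose (h := fun t => if excluded_middle_informative (P (gam t)) then 1 else 0).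
  assert (Hc : continuity h).
  { intros t eps Heps.
    destruct (Hloc _ (Dg t)) as [delta [Hd HD]].
    pose (N := Cmod (y - x)%C + 1); assert (HN : 0 < N) by (pose proof (Cmod_ge_0 (y - x)%C); unfold N; lra).
    exists (delta / N); split; [apply Rdiv_lt_0_compat; assumption|].
    intros s [_ Hs]; simpl in *; unfold Rdist in *.
    assert (K : P (gam s) <-> P (gam t)).
    { apply HD; [apply Dg|].
      apply Rle_lt_trans with (1 := Hg s t).
      apply Rle_lt_trans with (Rabs (s - t) * N).
      - apply Rmult_le_compat_l; [apply Rabs_pos | unfold N; lra].
      - replace delta with (delta / N * N) by (field; lra).
        apply Rmult_lt_compat_r; assumption. }
    replace (h s - h t) with 0; [rewrite Rabs_R0; exact Heps|].
    unfold h; do 2 destruct excluded_middle_informative; tauto || lra. }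
  assert (G0 : gam 0 = x).
  { unfold gam, cl; replace (Rmax 0 (Rmin 1 0)) with 0; [rewrite Rminus_0_r; ring|].
    rewrite Rmin_right, Rmax_left; lra. }
  assert (G1 : gam 1 = y).
  { unfold gam, cl; replace (Rmax 0 (Rmin 1 1)) with 1; [rewrite Rminus_diag; ring|].
    rewrite Rmin_left, Rmax_right; lra. }
  destruct (IVT_gen h 0 1 (1 / 2) Hc) as [t [_ Ht]].
  - assert (E0 : h 0 = 1) by (unfold h; rewrite G0; destruct excluded_middle_informative; tauto).
    assert (E1 : h 1 = 0) by (unfold h; rewrite G1; destruct excluded_middle_informative; tauto).
    rewrite E0, E1, Rmin_right, Rmax_left; lra.
  - unfold h in Ht; destruct excluded_middle_informative; lra.
Qed.

From mathcomp Require Import all_boot all_order all_algebra.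
From mathcomp Require Import boolp classical_sets filter.
From mathcomp Require Import sesquilinear spectral complex Rstruct.
From mathcomp Require Import ring.
Set Implicit Arguments. Unset Strict Implicit. Unset Printing Implicit Defensive.
Import Order.TTheory GRing.Theory Num.Theory.
Local Open Scope ring_scope.
Local Open Scope sesquilinear_scope.

(** * Leech factorization on a finite set *)

Section FiniteLeech.
Variable C : numClosedFieldType.

(** In the order of [C], [0 <= z] includes that z is real, so this matches both halves of
    [PosKernel]. *)
Definition fpsd (I : finType) (T : I -> I -> C) : Prop :=
  forall c : I -> C, 0 <= \sum_k \sum_l (c k)^* * c l * T k l.

Lemma adjmxM m n p (A : 'M[C]_(m, n)) (B : 'M[C]_(n, p)) :
  (A *m B)^t* = B^t* *m A^t*.
Proof. by rewrite trmx_mul map_mxM. Qed.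

Lemma adjmxB m n (A B : 'M[C]_(m, n)) : (A - B)^t* = A^t* - B^t*.
Proof. by rewrite linearB /= map_mxB. Qed.

Lemma mulmx_adj_ge0 n (v : 'rV[C]_n) : 0 <= (v *m v^t*) 0 0.
Proof. by rewrite mxE sumr_ge0 // => j _; rewrite !mxE mul_conjC_ge0. Qed.

Lemma mulmx_adj_eq0 n (v : 'rV[C]_n) : (v *m v^t*) 0 0 = 0 -> v = 0.
Proof.
rewrite mxE => /psumr_eq0P v0; apply/rowP => j; rewrite mxE.
have /eqP : v 0 j * v^t* j 0 = 0.
  by apply: v0 => // i _; rewrite !mxE mul_conjC_ge0.
by rewrite !mxE mul_conjC_eq0 => /eqP.
Qed.

Lemma quad_mxE n (v w : 'rV[C]_n) (L : 'M[C]_n) :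
  (v *m L *m w^t*) 0 0 = \sum_k \sum_l v 0 k * (w 0 l)^* * L k l.
Proof.
rewrite mxE exchange_big /=; apply: eq_bigr => l _; rewrite !mxE big_distrl /=.
by apply: eq_bigr => k _; rewrite -!mulrA; congr (_ * _); rewrite mulrC.
Qed.

Lemma fpsd_mx n (L : 'M[C]_n) :
  fpsd L -> forall v : 'rV_n, 0 <= (v *m L *m v^t*) 0 0.
Proof.
move=> HL v; have := HL (fun k => (v 0 k)^*); rewrite quad_mxE.
by under eq_bigr do under eq_bigr do rewrite conjCK.
Qed.

Lemma herm_diag n (L : 'M[C]_n) : L^t* = L ->
  exists2 PD : 'M[C]_n * 'rV[C]_n, PD.1 \is unitarymx
    & PD.1 *m L *m PD.1^t* = diag_mx PD.2.
Proof.
move=> HL; have /orthomx_spectralP E : L \is normalmx by apply/normalmxP; rewrite HL.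
have U := spectral_unitarymx L.
exists (spectralmx L, spectral_diag L) => //=.
rewrite [X in _ *m X *m _]E -!mulmxA mulKVmx ?spectral_unit //.
by rewrite (unitarymxP U) mulmx1.
Qed.

Lemma unitary_adjK n (P : 'M[C]_n) : P \is unitarymx -> P^t* *m P = 1%:M.
Proof. by move=> U; rewrite -(invmx_unitary U) mulVmx // unitarymx_unit. Qed.

Lemma psd_factor n (L : 'M[C]_n) : L^t* = L -> fpsd L ->
  exists l : 'M[C]_n, L = l *m l^t*.
Proof.
move=> HL HP; have [[P D] /= U E] := herm_diag HL.
have D0 j : 0 <= D 0 j.
  have := fpsd_mx HP (row j P).
  have -> : (row j P *m L *m (row j P)^t*) 0 0 = (P *m L *m P^t*) j j.
    rewrite -row_mul !mxE; apply: eq_bigr => k _; by rewrite !mxE.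
  by rewrite E mxE eqxx.
exists (P^t* *m diag_mx (map_mx sqrtC D)).
rewrite adjmxM trmxCK tr_diag_mx map_diag_mx mulmxA -[P^t* *m _ *m _]mulmxA mulmx_diag.
have -> : (\row_j (map_mx sqrtC D 0 j * map_mx Num.conj (map_mx sqrtC D) 0 j)) = D.
  apply/rowP => j; rewrite !mxE geC0_conj ?sqrtC_ge0 //.
  by rewrite -expr2 sqrtCK.
by rewrite -E -!mulmxA unitary_adjK // mulmx1 mulmxA unitary_adjK // mul1mx.
Qed.

(** The witness is the partial isometry W = A^* G^+ B, where G is the common Gram matrix and G^+ its
    pseudo-inverse. Then W W^* is an orthogonal projection Q, and 1 - Q = (1 - Q)(1 - Q)^* is
    positive. *)
Lemma equal_gram_contraction n p q (A : 'M[C]_(n, p)) (B : 'M[C]_(n, q)) :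
  A *m A^t* = B *m B^t* ->
  exists2 W : 'M[C]_(p, q), A *m W = B
    & forall v : 'rV_p, 0 <= (v *m (1%:M - W *m W^t*) *m v^t*) 0 0.
Proof.
move=> AB; have HG : (A *m A^t*)^t* = A *m A^t* by rewrite adjmxM trmxCK.
have [[P D] /= U E] := herm_diag HG.
have [A' A'E] : exists A', A' = P *m A by exists (P *m A).
have [B' B'E] : exists B', B' = P *m B by exists (P *m B).
(* Since the inverse of 0 is 0 here, [Di] is the pseudo-inverse of the spectrum. *)
pose Di : 'rV[C]_n := \row_j (D 0 j)^-1.
have EA : A' *m A'^t* = diag_mx D by rewrite A'E adjmxM -E !mulmxA.
have EB : B' *m B'^t* = diag_mx D by rewrite B'E adjmxM -E AB !mulmxA.
(* The eigenvalue is the squared norm of this row of [B'], so inverting only the nonzero eigenvalues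
   loses nothing of [B']. *)
have rB j : D 0 j = 0 -> row j B' = 0.
  move=> Dj; apply: mulmx_adj_eq0.
  have -> : (row j B' *m (row j B')^t*) 0 0 = (B' *m B'^t*) j j.
    by rewrite !mxE; apply: eq_bigr => k _; rewrite !mxE.
  by rewrite EB mxE eqxx Dj.
have DB : diag_mx D *m diag_mx Di *m B' = B'.
  rewrite mulmx_diag mul_diag_mx; apply/matrixP => j k; rewrite 3!mxE.
  have [Dj|Dj] := eqVneq (D 0 j) 0; last by rewrite divff // mul1r.
  by have /rowP /(_ k) := rB _ Dj; rewrite [LHS]mxE [RHS]mxE => ->; rewrite mulr0.
have Dr j : (D 0 j)^* = D 0 j.
  have : (A' *m A'^t*)^t* = A' *m A'^t* by rewrite adjmxM trmxCK.
  by rewrite EA => /matrixP /(_ j j); rewrite !mxE eqxx.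
have HDi : (diag_mx Di)^t* = diag_mx Di.
  rewrite tr_diag_mx map_diag_mx; congr diag_mx; apply/rowP => j.
  rewrite !mxE fmorphV; congr (_^-1); exact: Dr.
exists (A'^t* *m diag_mx Di *m B').
  have : P *m (A *m (A'^t* *m diag_mx Di *m B')) = P *m B.
    by rewrite !mulmxA -A'E EA DB.
  by move=> /(congr1 (mulmx (P^t*))); rewrite !mulmxA unitary_adjK // !mul1mx.
have -> : A'^t* *m diag_mx Di *m B' *m (A'^t* *m diag_mx Di *m B')^t*
   = A'^t* *m diag_mx Di *m A'.
  rewrite !adjmxM HDi trmxCK !mulmxA -[_ *m B' *m B'^t*]mulmxA EB.
  congr (_ *m _); rewrite -!mulmxA; congr (_ *m _); rewrite !mulmx_diag.
  congr diag_mx; apply/rowP => j; rewrite !mxE.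
  have [->|Dj] := eqVneq (D 0 j) 0; first by rewrite invr0 mul0r.
  by rewrite mulrA mulVf // mul1r.
set Q := A'^t* *m diag_mx Di *m A'.
have QH : Q^t* = Q by rewrite /Q !adjmxM HDi trmxCK mulmxA.
have QQ : Q *m Q = Q.
  rewrite /Q !mulmxA -[_ *m A' *m A'^t*]mulmxA EA.
  congr (_ *m _); rewrite -!mulmxA; congr (_ *m _); rewrite !mulmx_diag.
  congr diag_mx; apply/rowP => j; rewrite !mxE.
  have [->|Dj] := eqVneq (D 0 j) 0; first by rewrite invr0 mul0r.
  by rewrite mulrA mulVf // mul1r.
move=> v; have -> : v *m (1%:M - Q) *m v^t* = (v *m (1%:M - Q)) *m (v *m (1%:M - Q))^t*.
  rewrite adjmxM adjmxB QH trmx1 map_mx1 !mulmxA; congr (_ *m _).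
  rewrite -mulmxA; congr (_ *m _).
  by rewrite mulmxBl !mulmxBr !mulmx1 mul1mx QQ subrr subr0.
exact: mulmx_adj_ge0.
Qed.

(** [mxvec (b^T *m h)] models the tensor of b and h; inner products of elementary tensors factor. *)
Lemma mxvec_outer_dot d m (b c : 'rV[C]_d) (h k : 'rV[C]_m) :
  mxvec (b^T *m h) *m (mxvec (c^T *m k))^t* = (b *m c^t*) *m (h *m k^t*).
Proof.
have -> : (mxvec (c^T *m k))^t* = (mxvec (c^t* *m map_mx Num.conj k))^T.
  apply/matrixP => i j; rewrite !ord1 !mxE; case/mxvec_indexP: i => i1 i2.
  rewrite !mxvecE !mxE rmorph_sum; apply: eq_bigr => a _.
  by rewrite !mxE rmorphM.
rewrite mxvec_dotmul [X in X *m _]mulmxA -[LHS]mulmxA.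
have -> // : map_mx Num.conj k *m h^T = h *m k^t*.
apply/matrixP => i j; rewrite !ord1 !mxE; apply: eq_bigr => l _.
by rewrite !mxE mulrC.
Qed.

Lemma fpsd_gram n p (V : 'M[C]_(n, p)) (M : 'M[C]_p) :
  (forall v : 'rV_p, 0 <= (v *m M *m v^t*) 0 0) ->
  fpsd (fun k l => (row k V *m M *m (row l V)^t*) 0 0).
Proof.
move=> HM c; pose w : 'rV[C]_n := \row_k (c k)^*.
have := HM (w *m V).
have -> : (w *m V) *m M *m (w *m V)^t* = w *m (V *m M *m V^t*) *m w^t*.
  by rewrite adjmxM !mulmxA.
rewrite quad_mxE; congr (0 <= _); apply: eq_bigr => k _; apply: eq_bigr => l _.
rewrite !mxE conjCK; congr (_ * _); rewrite -row_mul.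
by apply: eq_bigr => j _; rewrite !mxE.
Qed.

Lemma unitmx_subr1 n (X : 'M[C]_n) :
  (forall h : 'rV_n, h *m X = h -> h = 0) -> 1%:M - X \in unitmx.
Proof.
move=> HX; rewrite -row_free_unit -kermx_eq0; apply/rowV0P => v /sub_kermxP.
by rewrite mulmxBr mulmx1 => /eqP; rewrite subr_eq0 => /eqP /esym /HX.
Qed.

(* Lurking isometry.  Write L = l l^*.  The rows (u_k, b_k (x) l_k) and (phi_k, l_k) have the same
   Gram matrix, hence are intertwined by a contraction with blocks P, Q, R, S, and
   psi_k = P + R (1 - Z_k S)^-1 Z_k Q, where h Z_k = b_k (x) h. *)
Lemma finite_leech n d (b u : 'M[C]_(n, d)) (phi : 'I_n -> C)
  (K : 'I_n -> 'I_n -> C) (dot := fun (x : 'M[C]_(n, d)) k l => \sum_a x k a * (x l a)^*)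
  (L := fun k l => (dot u k l - phi k * (phi l)^*) * K k l) :
  (forall k, dot b k k < 1) ->
  (forall k l, K k l * (1 - dot b k l) = 1) ->
  (forall k l, (K k l)^* = K l k) ->
  fpsd L ->
  exists psi : 'M[C]_(n, d),
    (forall k, phi k = \sum_a u k a * psi k a) /\
    forall a, exists h : 'M[C]_n, exists2 T : 'I_n -> 'I_n -> C, fpsd T &
      forall k l, 1 - psi k a * (psi l a)^* =
        T k l + (\sum_j h k j * (h l j)^*) * (1 - dot b k l).
Proof.
move=> Hb HK HKs HL.
have dotE x k l : dot x k l = (row k x *m (row l x)^t*) 0 0.
  by rewrite mxE; apply: eq_bigr => a _; rewrite !mxE.
have dots x k l : (dot x k l)^* = dot x l k.
  by rewrite rmorph_sum; apply: eq_bigr => a _; rewrite rmorphM /= conjCK mulrC.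
have [l El] : exists l : 'M[C]_n, (\matrix_(i, j) L i j) = l *m l^t*.
  apply: psd_factor.
    apply/matrixP => i j; rewrite !mxE /L rmorphM rmorphB rmorphM /= conjCK HKs dots.
    by rewrite [X in _ - X]mulrC.
  move=> c; under eq_bigr do under eq_bigr do rewrite mxE; exact: HL.
have El' i j : L i j = (row i l *m (row j l)^t*) 0 0.
  have /matrixP /(_ i j) := El; rewrite mxE => ->; rewrite !mxE.
  by apply: eq_bigr => a _; rewrite !mxE.
pose A : 'M[C]_(n, d + d * n) := \matrix_k row_mx (row k u) (mxvec ((row k b)^T *m row k l)).
pose B : 'M[C]_(n, 1 + n) := \matrix_k row_mx (phi k)%:M (row k l).
(* This is the definition of [L], multiplied by 1 - <b_i, b_j> to cancel [K] and rearranged so that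
   only plus signs remain. *)
have AB : A *m A^t* = B *m B^t*.
  apply/matrixP => i j.
  have rowg p (M : 'M[C]_(n, p)) : (M *m M^t*) i j = (row i M *m (row j M)^t*) 0 0.
    by rewrite !mxE; apply: eq_bigr => a _; rewrite !mxE.
  rewrite !rowg !rowK !tr_row_mx !map_col_mx !mul_row_col mxvec_outer_dot.
  rewrite [LHS]mxE [RHS]mxE -dotE -El'.
  have -> : (row i b *m (row j b)^t* *m (row i l *m (row j l)^t*)) 0 0
     = dot b i j * L i j by rewrite [LHS]mxE big_ord1 -dotE -El'.
  have -> : ((phi i)%:M *m ((phi j)%:M^t*) : 'M[C]_1) 0 0 = phi i * (phi j)^*.
    by rewrite [LHS]mxE big_ord1 !mxE eqxx.
  have -> : dot u i j = phi i * (phi j)^* + L i j * (1 - dot b i j).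
    by rewrite /L -mulrA HK mulr1 addrC subrK.
  ring.
have [W EW HW] := equal_gram_contraction AB.
pose P := lsubmx (usubmx W); pose Q := lsubmx (dsubmx W).
pose R := rsubmx (usubmx W); pose S := rsubmx (dsubmx W).
pose Z k : 'M[C]_(n, d * n) := lin1_mx (mxvec \o mulmx (row k b)^T).
have ZE k h : h *m Z k = mxvec ((row k b)^T *m h).
  by rewrite /Z mul_rV_lin1.
have rowW e z : row_mx e z *m W = row_mx (e *m P + z *m Q) (e *m R + z *m S).
  by rewrite -[W]vsubmxK mul_row_col -[usubmx W]hsubmxK -[dsubmx W]hsubmxK
    !mul_mx_row add_row_mx.
(* If h = h Z_k S, contractivity of [W] on (0, h Z_k) gives |h|^2 <= |b_k|^2 |h|^2, and |b_k| < 1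
   forces h = 0. *)
have U k : 1%:M - Z k *m S \in unitmx.
  apply: unitmx_subr1 => h; rewrite mulmxA => hE.
  apply: mulmx_adj_eq0; apply/eqP; rewrite eq_le mulmx_adj_ge0 andbT.
  have := HW (row_mx 0 (h *m Z k)).
  rewrite mulmxBr mulmx1 mulmxBl mulmxA -[_ *m W *m _ *m _]mulmxA -adjmxM rowW.
  rewrite !mul0mx !add0r hE !tr_row_mx !map_col_mx !mul_row_col mul0mx add0r.
  rewrite ZE mxvec_outer_dot => H.
  have {H} : (h *m h^t*) 0 0 <= dot b k k * (h *m h^t*) 0 0.
    rewrite -subr_ge0; apply: le_trans H _; rewrite [leLHS]mxE.
    rewrite [X in X + _]mxE big_ord1 -dotE lerD2l [leLHS]mxE lerN2 [leRHS]mxE lerDr.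
    exact: mulmx_adj_ge0.
  rewrite -subr_ge0 -{2}[(h *m _) 0 0]mul1r -mulrBl nmulr_rge0 // subr_lt0.
  exact: Hb.
have [H defH] : exists H, forall k, H k = R *m invmx (1%:M - Z k *m S).
  by exists (fun k => R *m invmx (1%:M - Z k *m S)).
have HE k : H k = R + H k *m Z k *m S.
  have : H k *m (1%:M - Z k *m S) = R by rewrite defH mulmxKV.
  by rewrite mulmxBr mulmx1 mulmxA => /eqP; rewrite subr_eq => /eqP.
exists (\matrix_(k, a) (P + H k *m Z k *m Q) a 0); split.
  move=> k; have := congr1 (row k) EW; rewrite row_mul !rowK rowW -ZE.
  move=> /eq_row_mx [E1 E2].
  have lE : row k l = row k u *m H k.
    have : row k l *m (1%:M - Z k *m S) = row k u *m R.
      by rewrite mulmxBr mulmx1 -{1}E2 mulmxA addrK.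
    by move=> /(congr1 (mulmx^~ (invmx (1%:M - Z k *m S)))); rewrite mulmxK // -mulmxA -defH.
  have /matrixP /(_ 0 0) := E1; rewrite [RHS]mxE eqxx mulr1n => <-.
  rewrite lE -!mulmxA -mulmxDr mulmxA [LHS]mxE.
  apply: eq_bigr => a _; congr (_ * _); first by rewrite mxE.
  by rewrite [RHS]mxE -!mulmxA.
(* [W] sends (e, e H_k Z_k) to (psi_k, e H_k). Comparing Gram matrices, the defect of the
   contraction is [T], and the two copies of <h_k, h_l> combine with the factor 1 - <b_k, b_l>. *)
move=> a; pose e : 'rV[C]_d := delta_mx 0 a.
pose h : 'M[C]_n := \matrix_k (e *m H k).
pose V : 'M[C]_(n, d + d * n) := \matrix_k row_mx e (e *m H k *m Z k).
exists h, (fun k l => (row k V *m (1%:M - W *m W^t*) *m (row l V)^t*) 0 0).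
  exact: fpsd_gram.
move=> i j.
have rVW k : row k V *m W = row_mx ((P + H k *m Z k *m Q) a 0)%:M (row k h).
  rewrite !rowK rowW; congr row_mx.
    apply/matrixP => x y; rewrite !ord1 -!mulmxA -mulmxDr mulmxA -rowE.
    by rewrite [LHS]mxE [RHS]mxE eqxx mulr1n.
  by rewrite -!mulmxA -mulmxDr mulmxA -HE.
rewrite mulmxBr mulmx1 mulmxBl mulmxA -[_ *m W *m _ *m _]mulmxA -adjmxM !rVW.
rewrite !rowK !tr_row_mx !map_col_mx !mul_row_col !ZE mxvec_outer_dot.
have -> : \sum_j0 h i j0 * (h j j0)^* = (e *m H i *m (e *m H j)^t*) 0 0.
  by rewrite [RHS]mxE; apply: eq_bigr => x _; rewrite !mxE.
move: (e *m H i *m _) => t; rewrite [X in _ = X + _]mxE.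
have e1 : (e *m e^t*) 0 0 = 1.
  rewrite -rowE mxE !mxE !eqxx; exact: conjC1.
rewrite [X in _ = X + _ + _]mxE e1 [X in _ = _ + X + _ + _]mxE big_ord1 -dotE.
rewrite [X in _ = _ + X + _]mxE [X in _ = _ - X + _]mxE.
rewrite [X in _ = _ - (X + _) + _]mxE big_ord1.
rewrite (_ : (\matrix_(k, a0) (P + H k *m Z k *m Q) a0 0) i a = (P + H i *m Z i *m Q) a 0);
  last by rewrite [LHS]mxE.
rewrite (_ : (\matrix_(k, a0) (P + H k *m Z k *m Q) a0 0) j a = (P + H j *m Z j *m Q) a 0);
  last by rewrite [LHS]mxE.
move: ((P + _) a 0) ((P + _) a 0) => x y.
rewrite (_ : t ord0 0 = t 0 0) //; move: (t 0 0) (dot b i j) => {}t q.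
rewrite !mxE /= !mulr1n; ring.
Qed.
End FiniteLeech.

(** * Positive kernels *)

Notation CC := (complex Rdefinitions.R).

(** For p = |p| the distance from q to |q| is at most 2 |q - p|, hence arbitrarily small. This
    closedness of the positive cone carries all passages to a limit. *)
Lemma ge0_approx (q : CC) :
  (forall e : CC, 0 < e -> exists2 p : CC, 0 <= p & `|q - p| < e) -> 0 <= q.
Proof.
move=> H; suff -> : q = `|q| by exact: normr_ge0.
apply/eqP; rewrite -subr_eq0 -normr_eq0; apply/negP => /negP n0.
have e0 : 0 < `|q - `|q| | / 2 by rewrite divr_gt0 // lt_neqAle eq_sym n0 normr_ge0.
have [p p0 Hp] := H _ e0; have := le_lt_trans _ Hp.
move=> /(_ (`|q - `|q| | / 2)); rewrite ltxx => K; apply: notF; apply: K.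
rewrite ler_pdivrMr // mulr2n mulrDr !mulr1.
have -> : q - `|q| = (q - p) + (p - `|q|) by ring.
apply: le_trans (ler_normD _ _) _; rewrite lerD2l -{1}(ger0_norm p0) distrC.
exact: (le_trans (ler_dist_dist _ _)).
Qed.

Lemma geom_small (t : CC) (A e : CC) : `|t| < 1 -> 0 < e ->
  exists N0, forall N, (N0 <= N)%N -> `|A * t ^+ N| < e.
Proof.
move=> t1 e0.
have [[a Ea] [r Er] [f Ef]] : [/\ exists a, `|A| + 1 = a%:C%C,
   exists r, `|t| = r%:C%C & exists f, e = f%:C%C].
  split; apply/complex_realP; [|exact: normr_real|exact: gtr0_real].
  by rewrite realD // ?normr_real ?real1.
have a0 : 0 < a by rewrite -ltcR -Ea ltr_wpDl.
have f0 : 0 < f by rewrite -ltcR -Ef.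
have r0 : 0 <= r by rewrite -ler0c -Er normr_ge0.
have r1 : r < 1 by rewrite -ltcR -Er.
have [||N0 HN] := @pow_lt_1_zero r _ (f / a).
- by rewrite Rstruct.RabsE; apply/RltP; rewrite ger0_norm.
- by apply/RltP; rewrite divr_gt0.
exists N0 => N /ssrnat.leP NN; rewrite normrM normrX Er.
have /RltP := HN N NN; rewrite Rstruct.RabsE Rstruct.RpowE (ger0_norm (exprn_ge0 N r0)).
rewrite ltr_pdivlMr // -ltcR => H.
rewrite Ef -rmorphXn /=; apply: le_lt_trans H.
by rewrite rmorphM /= -Ea mulrC; apply: ler_wpM2l; rewrite ?lerDl // ler0c exprn_ge0.
Qed.

Definition null (a : nat -> CC) :=
  forall e : CC, 0 < e -> exists N0, forall N, (N0 <= N)%N -> `|a N| < e.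

Lemma null_sum (I : finType) (a : I -> nat -> CC) :
  (forall i, null (a i)) -> null (fun N => \sum_i a i N).
Proof.
move=> Ha e e0; elim: (index_enum I) e e0 => [|i s IH] e e0.
  by exists 0%N => N _; rewrite big_nil normr0.
have e2 : 0 < e / 2 by rewrite divr_gt0.
have [N1 H1] := IH _ e2; have [N2 H2] := Ha i _ e2.
exists (maxn N1 N2) => N; rewrite geq_max => /andP[/H1 h1 /H2 h2].
rewrite big_cons (splitr e); apply: le_lt_trans (ler_normD _ _) _.
exact: ltrD.
Qed.

(** Arbitrary finite index types, rather than initial segments of the integers, allow points to be
    adjoined by a sum type. *)
Definition PSD (X : Type) (K : X -> X -> CC) : Prop :=
  forall (I : finType) (x : I -> X), fpsd (fun i j => K (x i) (x j)).

Section PSDcalculus.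
Variable X : Type.
Implicit Types K L : X -> X -> CC.

Lemma PSD_ext K L : (forall x y, K x y = L x y) -> PSD K -> PSD L.
Proof.
move=> E HK I x c; have := HK I x c.
by under eq_bigr do under eq_bigr do rewrite E.
Qed.

Lemma PSD_add K L : PSD K -> PSD L -> PSD (fun x y => K x y + L x y).
Proof.
move=> HK HL I x c.
under eq_bigr do under eq_bigr do rewrite mulrDr.
under eq_bigr do rewrite big_split /=.
by rewrite big_split /= addr_ge0 ?HK ?HL.
Qed.

Lemma PSD_scale (a : CC) K : 0 <= a -> PSD K -> PSD (fun x y => a * K x y).
Proof.
move=> a0 HK I x c.
under eq_bigr do under eq_bigr do rewrite mulrCA.
under eq_bigr do rewrite -mulr_sumr.
by rewrite -mulr_sumr mulr_ge0 ?HK.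
Qed.

Lemma PSD0 : PSD (fun _ _ : X => 0).
Proof. by move=> I x c; rewrite big1 // => i _; rewrite big1 // => j _; rewrite mulr0. Qed.

Lemma PSD_sum (J : finType) (K : J -> X -> X -> CC) :
  (forall j, PSD (K j)) -> PSD (fun x y => \sum_j K j x y).
Proof.
move=> HK; elim: (index_enum J) => [|j s IH].
  by apply: PSD_ext PSD0 => x y; rewrite big_nil.
by apply: PSD_ext (PSD_add (HK j) IH) => x y; rewrite big_cons.
Qed.

Lemma PSD_congr (u : X -> CC) K :
  PSD K -> PSD (fun x y => u x * K x y * (u y)^*).
Proof.
move=> HK I x c; have := HK I x (fun i => c i * (u (x i))^*).
congr (0 <= _); apply: eq_bigr => i _; apply: eq_bigr => j _.
rewrite rmorphM /= conjCK; ring.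
Qed.

Lemma PSD1 : PSD (fun _ _ : X => 1).
Proof.
move=> I x c; under eq_bigr do under eq_bigr do rewrite mulr1.
under eq_bigr do rewrite -mulr_sumr.
by rewrite -mulr_suml -rmorph_sum /= mulrC mul_conjC_ge0.
Qed.

Lemma PSD_rank1 (u : X -> CC) : PSD (fun x y => u x * (u y)^*).
Proof. by apply: PSD_ext (PSD_congr u PSD1) => x y; rewrite mulr1. Qed.

Lemma PSD_pull (Y : Type) (f : Y -> X) K : PSD K -> PSD (fun x y => K (f x) (f y)).
Proof. by move=> HK I x; exact: (HK I (f \o x)). Qed.

(** Adjoin x0 with the coefficient -s / K(x0, x0), which minimises the form in that variable; the
    minimum is the form of the Schur complement. *)
Lemma PSD_schur (x0 : X) K : (forall x y, (K x y)^* = K y x) -> 0 < K x0 x0 ->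
  PSD K -> PSD (fun x y => K x y - K x x0 * K x0 y / K x0 x0).
Proof.
move=> Ks K0 HK I x c.
pose s := \sum_j c j * K x0 (x j).
have sE : s^* = \sum_i (c i)^* * K (x i) x0.
  by rewrite rmorph_sum; apply: eq_bigr => i _; rewrite rmorphM /= Ks.
have := HK (unit + I)%type (fun p => if p is inr i then x i else x0)
  (fun p => if p is inr i then c i else - s / K x0 x0).
have kr : (K x0 x0)^* = K x0 x0 by rewrite Ks.
have kn : K x0 x0 != 0 by rewrite gt_eqF.
rewrite big_sumType /= big_sumType /=.
have -> (F : unit -> CC) : \sum_i F i = F tt.
  by rewrite (bigD1 tt) //= big1 ?addr0 // => -[].
under [X in _ + X]eq_bigr do rewrite big_sumType /=.
have -> (F : unit -> CC) : \sum_i F i = F tt.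
  by rewrite (bigD1 tt) //= big1 ?addr0 // => -[].
have -> : \sum_i (- s / K x0 x0)^* * c i * K x0 (x i) = (- s / K x0 x0)^* * s.
  by rewrite mulr_sumr; apply: eq_bigr => i _; rewrite mulrA.
rewrite big_split /=.
have E1 : \sum_i \sum_(i0 : unit) (c i)^* * (- s / K x0 x0) * K (x i) x0 = s^* * (- s / K x0 x0).
  rewrite sE mulr_suml; apply: eq_bigr => i _.
  by rewrite (bigD1 tt) //= big1 ?addr0 => [|[]//]; rewrite mulrAC.
rewrite E1; congr (0 <= _).
have -> : \sum_i \sum_j (c i)^* * c j * (K (x i) (x j) - K (x i) x0 * K x0 (x j) / K x0 x0)
    = \sum_i \sum_j (c i)^* * c j * K (x i) (x j) - s^* * s / K x0 x0.
  rewrite sE 2!mulr_suml -sumrB; apply: eq_bigr => i _.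
  rewrite mulr_sumr mulr_suml -sumrB; apply: eq_bigr => j _; ring.
rewrite rmorphM fmorphV /= rmorphN kr; by field.
Qed.

End PSDcalculus.

(** * Multipliers of ball kernels *)

Definition dot (d : nat) (v w : 'I_d -> CC) : CC := \sum_a v a * (w a)^*.

Section Dot.
Variable d : nat.
Implicit Types v w : 'I_d -> CC.

Lemma dotC v w : (dot v w)^* = dot w v.
Proof. by rewrite rmorph_sum; apply: eq_bigr => a _; rewrite rmorphM /= conjCK mulrC. Qed.

Lemma dot_ge0 v : 0 <= dot v v.
Proof. by apply: sumr_ge0 => a _; rewrite mul_conjC_ge0. Qed.

(** Summing 2 |v_a w_a| <= |v_a|^2 + |w_a|^2 suffices. The vector w may lie on the sphere, as needed
    to exclude boundary characters. *)
Lemma norm_dot_lt1 v w : dot v v < 1 -> dot w w <= 1 -> `|dot v w| < 1.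
Proof.
move=> Hv Hw; have H : `|dot v w| *+ 2 <= dot v v + dot w w.
  rewrite -mulr_natl; apply: le_trans (ler_wpM2l _ (ler_norm_sum _ _ _)) _ => //.
  rewrite mulr_sumr -big_split /=; apply: ler_sum => a _.
  rewrite -!normCK normrM norm_conjC -subr_ge0.
  have -> : `|v a| ^+ 2 + `|w a| ^+ 2 - 2%:R * (`|v a| * `|w a|) = (`|v a| - `|w a|) ^+ 2.
    ring.
  by rewrite real_exprn_even_ge0 // realB // normr_real.
have : `|dot v w| *+ 2 < 1 *+ 2.
  by apply: le_lt_trans H _; rewrite mulr2n ltr_leD.
by rewrite ltr_pMn2r.
Qed.

(** The polarised Lagrange identity. Its right-hand side is a sum of rank-one kernels, so it is the
    Cauchy-Schwarz inequality at the level of kernels. *)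
Lemma dot_lagrange v w l :
  dot l l * dot v w - dot v l * dot l w =
  2%:R^-1 * \sum_i \sum_j (v i * l j - v j * l i) * (w i * l j - w j * l i)^*.
Proof.
have E : \sum_i \sum_j (v i * l j - v j * l i) * (w i * l j - w j * l i)^* =
  2%:R * (dot l l * dot v w - dot v l * dot l w).
  under eq_bigr => i _.
    under eq_bigr => j _.
      rewrite (_ : _ * _ = (v i * (w i)^* * (l j * (l j)^*) + l i * (l i)^* * (v j * (w j)^*))
        - (v i * (l i)^* * (l j * (w j)^*) + l i * (w i)^* * (v j * (l j)^*))); last first.
        by rewrite rmorphB !rmorphM /=; ring.
      over.
    rewrite sumrB !big_split /= -!mulr_sumr.
    over.
  rewrite sumrB !big_split /= -!mulr_suml -/(dot v w) -/(dot l l) -/(dot v l) -/(dot l w).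
  ring.
by rewrite E mulKf // pnatr_eq0.
Qed.

End Dot.

Section Multipliers.
Variables (X : Type) (d : nat) (b : X -> 'I_d -> CC).
Hypothesis ball : forall x, dot (b x) (b x) < 1.

Definition ker (x y : X) : CC := (1 - dot (b x) (b y))^-1.

Lemma ker_den x y : 1 - dot (b x) (b y) != 0.
Proof.
apply/negP => /eqP E; have := norm_dot_lt1 (ball x) (ltW (ball y)).
by rewrite (_ : dot _ _ = 1) ?normr1 ?ltxx //; apply/esym/eqP; rewrite -subr_eq0 E.
Qed.

Lemma kerK x y : ker x y * (1 - dot (b x) (b y)) = 1.
Proof. by rewrite mulVf // ker_den. Qed.

Lemma ker_neq0 x y : ker x y != 0.
Proof. by rewrite invr_eq0 ker_den. Qed.

Lemma kerC x y : (ker x y)^* = ker y x.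
Proof. by rewrite fmorphV rmorphB rmorph1 /= dotC. Qed.

Lemma ker_gt0 x : 0 < ker x x.
Proof. by rewrite invr_gt0 subr_gt0. Qed.

Definition psd (A : X -> X -> CC) := PSD (fun x y => A x y * ker x y).

(* Expand the kernel as a geometric series: each partial sum is a sum of congruences of [A]. *)
Lemma PSD_psd A : PSD A -> psd A.
Proof.
move=> HA.
have HP N : PSD (fun x y => A x y * dot (b x) (b y) ^+ N).
  elim: N => [|N IH]; first by apply: PSD_ext HA => x y; rewrite mulr1.
  apply: PSD_ext (PSD_sum (fun a => PSD_congr (b^~ a) IH)) => x y.
  rewrite exprS mulrCA mulr_suml; apply: eq_bigr => a _; ring.
have HS N : PSD (fun x y => A x y * \sum_(n < N) dot (b x) (b y) ^+ n).
  by apply: PSD_ext (PSD_sum (fun n : 'I_N => HP n)) => x y; rewrite mulr_sumr.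
move=> I x c; apply: ge0_approx => e e0.
have Hn : null (fun N => \sum_i \sum_j
   (c i)^* * c j * A (x i) (x j) * ker (x i) (x j) * dot (b (x i)) (b (x j)) ^+ N).
  apply: null_sum => i; apply: null_sum => j f f0.
  exact: geom_small (norm_dot_lt1 _ (ltW _)) f0.
have [N /(_ N (leqnn N)) HN] := Hn _ e0.
exists (\sum_i \sum_j (c i)^* * c j *
   (A (x i) (x j) * \sum_(n < N) dot (b (x i)) (b (x j)) ^+ n)).
  exact: HS.
rewrite -sumrB; under eq_bigr do rewrite -sumrB.
apply: le_lt_trans HN; rewrite le_eqVlt; apply/orP; left; apply/eqP; congr `|_|.
apply: eq_bigr => i _; apply: eq_bigr => j _; rewrite -mulrBr -!mulrA; congr (_ * (_ * _)).
rewrite -mulrBr; congr (_ * _); set t := dot _ _.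
have K1 := kerK (x i) (x j); have := subrX1 t N; rewrite -/t in K1 * => E.
have -> : t ^+ N = 1 - (1 - t) * \sum_(n < N) t ^+ n by rewrite -[1 - t]opprB mulNr -E; ring.
by rewrite mulrBr mulr1 mulrA K1 mul1r.
Qed.

Lemma psd_ext A B : (forall x y, A x y = B x y) -> psd A -> psd B.
Proof. by move=> E; apply: PSD_ext => x y; rewrite E. Qed.

Lemma psd_add A B : psd A -> psd B -> psd (fun x y => A x y + B x y).
Proof. by move=> HA HB; apply: PSD_ext (PSD_add HA HB) => x y; rewrite mulrDl. Qed.

Lemma psd_scale a A : 0 <= a -> psd A -> psd (fun x y => a * A x y).
Proof. by move=> a0 HA; apply: PSD_ext (PSD_scale a0 HA) => x y; rewrite mulrA. Qed.

Lemma psd_congr u A : psd A -> psd (fun x y => u x * A x y * (u y)^*).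
Proof. move=> HA; apply: PSD_ext (PSD_congr u HA) => x y; ring. Qed.

Lemma psd_rank1 u : psd (fun x y => u x * (u y)^*).
Proof. exact: PSD_psd (PSD_rank1 u). Qed.

Lemma psd1 : psd (fun _ _ => 1).
Proof. exact: PSD_psd (@PSD1 X). Qed.

Definition mult (phi : X -> CC) (M : CC) : Prop :=
  0 <= M /\ psd (fun x y => M ^+ 2 - phi x * (phi y)^*).

Lemma mult_ext phi psi M : (forall x, phi x = psi x) -> mult phi M -> mult psi M.
Proof. by move=> E [M0 H]; split=> //; apply: psd_ext H => x y; rewrite !E. Qed.

Lemma mult_le phi M M' : M <= M' -> mult phi M -> mult phi M'.
Proof.
move=> MM [M0 H]; split; first exact: le_trans MM.
have P0 : 0 <= M' ^+ 2 - M ^+ 2.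
  by rewrite subr_ge0 lerXn2r // nnegrE // (le_trans M0).
apply: psd_ext (psd_add H (psd_scale P0 psd1)) => x y; ring.
Qed.

Lemma mult_bound phi M x : mult phi M -> `|phi x| <= M.
Proof.
move=> [M0 H]; have := H unit (fun _ => x) (fun _ => 1).
have S1 (F : unit -> CC) : \sum_i F i = F tt.
  by rewrite (bigD1 tt) //= big1 ?addr0 // => -[].
rewrite !S1 rmorph1 !mul1r pmulr_lge0 ?ker_gt0 // subr_ge0 -normCK.
by rewrite ler_sqr ?nnegrE.
Qed.

Lemma mult_cst (a : CC) : mult (fun _ => a) `|a|.
Proof.
split=> //; apply: psd_ext (psd_scale (lexx 0) psd1) => x y.
by rewrite normCK; ring.
Qed.

Lemma multM phi psi M M' : mult phi M -> mult psi M' ->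
  mult (fun x => phi x * psi x) (M * M').
Proof.
move=> [M0 H] [M0' H']; split; first exact: mulr_ge0.
apply: psd_ext (psd_add (psd_scale (exprn_ge0 2 M0') H) (psd_congr phi H')) => x y.
rewrite rmorphM /=; ring.
Qed.

Lemma multZ a phi M : mult phi M -> mult (fun x => a * phi x) (`|a| * M).
Proof. exact: multM (mult_cst a). Qed.

Lemma multX phi M n : mult phi M -> mult (fun x => phi x ^+ n) (M ^+ n).
Proof.
move=> H; elim: n => [|n IH].
  by have := mult_cst 1; rewrite normr1.
rewrite exprS; apply: mult_ext (multM H IH) => x; by rewrite exprS.
Qed.

(** The triangle inequality as an exact identity: (1 + M'/M) and (1 + M/M') times the two
    hypotheses, plus M'/M times the rank-one kernel of phi - (M/M') psi. The divisions are the
    reason for strict positivity. *)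
Lemma multD phi psi M M' : 0 < M -> 0 < M' -> mult phi M -> mult psi M' ->
  mult (fun x => phi x + psi x) (M + M').
Proof.
move=> M0 M0' [_ H] [_ H']; split; first by rewrite addr_ge0 // ltW.
have Mn : M != 0 by rewrite gt_eqF.
have Mn' : M' != 0 by rewrite gt_eqF.
have a0 : 0 <= M' / M by rewrite divr_ge0 // ltW.
have a1 : 0 <= 1 + M' / M by rewrite addr_ge0.
have a2 : 0 <= 1 + M / M' by rewrite addr_ge0 // divr_ge0 // ltW.
have Mr : M^* = M by rewrite geC0_conj // ltW.
have Mr' : M'^* = M' by rewrite geC0_conj // ltW.
apply: psd_ext (psd_add (psd_add (psd_scale a1 H) (psd_scale a2 H'))
  (psd_scale a0 (psd_rank1 (fun x => phi x - M / M' * psi x)))) => x y.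
rewrite !(rmorphB, rmorphD, rmorphM) /= fmorphV /= Mr Mr'; field.
by rewrite Mn Mn'.
Qed.

(** Split |a|^2 - <x,a><a,y> into |a|^2 (1 - <x,y>), which the kernel turns into a constant, and the
    positive Lagrange term. *)
Lemma mult_dot (a : 'I_d -> CC) s : 0 <= s -> s ^+ 2 = dot a a ->
  mult (fun x => dot (b x) a) s.
Proof.
move=> s0 sE; split => //.
have H1 : psd (fun x y => dot a a * (1 - dot (b x) (b y))).
  apply: PSD_ext (PSD_scale (dot_ge0 a) (@PSD1 X)) => x y.
  by rewrite -mulrA [_ * ker _ _]mulrC kerK.
have H2 : psd (fun x y => dot a a * dot (b x) (b y) - dot (b x) a * dot a (b y)).
  apply: PSD_psd; have h0 : 0 <= 2%:R^-1 :> CC by rewrite invr_ge0.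
  apply: PSD_ext (PSD_scale h0 (PSD_sum (fun i => PSD_sum (fun j =>
    PSD_rank1 (fun x => b x i * a j - b x j * a i))))) => x y.
  by rewrite dot_lagrange.
apply: psd_ext (psd_add H1 H2) => x y; rewrite sE dotC; ring.
Qed.

Lemma mult_coord a : mult (fun x => b x a) 1.
Proof.
have := @mult_dot (fun i => (i == a)%:R) 1 ler01.
have E v : dot v (fun i => (i == a)%:R) = v a.
  rewrite /dot (bigD1 a) //= eqxx rmorph1 mulr1 big1 ?addr0 // => i /negPf ->.
  by rewrite rmorph0 mulr0.
rewrite !E eqxx expr1n => /(_ erefl); apply: mult_ext => x; exact: E.
Qed.

Lemma mult_resolvent u M z : 0 < M -> M < `|z| -> mult u M ->
  (forall x, z - u x != 0) /\ mult (fun x => (z - u x)^-1) (`|z| - M)^-1.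
Proof.
move=> M0 Mz Hu; have nz x : z - u x != 0.
  rewrite subr_eq0; apply/negP => /eqP E; have := mult_bound x Hu.
  by rewrite -E => /(lt_le_trans Mz); rewrite ltxx.
have [_ H] := Hu; have z0 : 0 < `|z| by exact: lt_trans Mz.
have zn : `|z| != 0 by rewrite gt_eqF.
have Mn : M != 0 by rewrite gt_eqF.
have D0 : 0 < `|z| - M by rewrite subr_gt0.
split=> //; split; first by rewrite invr_ge0 ltW.
have a1 : 0 <= `|z| / M by rewrite divr_ge0 // ltW.
have a2 : 0 <= `|z| / M - 1 by rewrite subr_ge0 ler_pdivlMr // mul1r ltW.
have Mr : M^* = M by rewrite geC0_conj // ltW.
have zr : `|z|^* = `|z| by rewrite geC0_conj // ltW.
have H1 := psd_add (psd_scale a1 (psd_rank1 (fun x => u x - M / `|z| * z))) (psd_scale a2 H).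
have d0 : 0 <= (`|z| - M)^-1 ^+ 2 by rewrite exprn_ge0 // invr_ge0 ltW.
apply: psd_ext (psd_scale d0 (psd_congr (fun x => (z - u x)^-1) H1)) => x y.
have nzc : z^* - (u y)^* != 0 by rewrite -rmorphB fmorph_eq0.
have point : z * z^* = `|z| ^+ 2 by rewrite normCK.
have -> : `|z| / M * ((u x - M / `|z| * z) * (u y - M / `|z| * z)^*) +
    (`|z| / M - 1) * (M ^+ 2 - u x * (u y)^*)
  = (z - u x) * (z - u y)^* - (`|z| - M) ^+ 2.
  rewrite !rmorphB !rmorphM /= fmorphV /= Mr zr.
  have -> : (z - u x) * (z^* - (u y)^*) = `|z| ^+ 2 - z * (u y)^* - u x * z^* + u x * (u y)^*.
    by rewrite -point; ring.
  have -> : (u x - M / `|z| * z) * ((u y)^* - M / `|z| * z^*) =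
    u x * (u y)^* - M / `|z| * (z * (u y)^* + u x * z^*) + (M / `|z|) ^+ 2 * `|z| ^+ 2.
    by rewrite -point; ring.
  field; by rewrite zn Mn.
rewrite fmorphV /= rmorphB; field.
by rewrite nzc nz gt_eqF.
Qed.

End Multipliers.

(** * Leech factorization *)

Lemma complex_norm_small (z : CC) (e : R) :
  `|complex.Re z| < e -> `|complex.Im z| < e -> `|z| < (e *+ 2)%:C%C.
Proof.
move=> H1 H2; rewrite [z]complexE; apply: le_lt_trans (ler_normD _ _) _.
rewrite mulr2n rmorphD /=; apply: ltrD.
  by rewrite normc_def /= expr0n addr0 sqrtr_sqr ltcR.
rewrite normrM (_ : `|'i%C| = 1 :> CC); last first.
  by rewrite normc_def /= expr0n expr1n add0r sqrtr1.
by rewrite mul1r normc_def /= expr0n addr0 sqrtr_sqr ltcR.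
Qed.

Lemma complex_norm_ge (z : CC) (e : R) : `|z| <= e%:C%C ->
  `|complex.Re z| <= e /\ `|complex.Im z| <= e.
Proof.
rewrite normc_def lecR => H; split; apply: le_trans H.
  by rewrite -sqrtr_sqr ler_sqrt ?lerDl ?sqr_ge0 // addr_ge0 // sqr_ge0.
by rewrite -sqrtr_sqr ler_sqrt ?lerDr ?sqr_ge0 // addr_ge0 // sqr_ge0.
Qed.

Lemma in_List (T : eqType) (x : T) s : x \in s -> List.In x s.
Proof.
elim: s => // y s IH; rewrite inE => /orP[/eqP ->|/IH]; by [left|right].
Qed.

(** * Pointwise cluster points of bounded families *)

Section Compactness.
Local Open Scope classical_set_scope.

(** The limit is the supremum of those r with r <= a(t) for U-almost every t; the ultrafilter
    decides every comparison above it. *)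
Lemma ultra_lim (T : Type) (U : set_system T) (a : T -> R) : UltraFilter U ->
  (forall t, `|a t| <= 1) -> exists l : R, forall e : R, 0 < e -> U [set t | `|a t - l| < e].
Proof.
move=> UU a1; pose E : R -> Prop := fun r => U [set t | r <= a t].
have [||l [l1 l2]] := completeness E.
- exists 1 => r Er; apply/RleP; have [t /= rt] := filter_ex Er.
  apply: le_trans rt _; exact: le_trans (ler_norm _) (a1 t).
- exists (-1); apply: filterS filterT => t _ /=.
  by have := a1 t; rewrite ler_norml => /andP[].
exists l => e e0.
have [r Er lr] : exists2 r, E r & l - e < r.
  apply: contrapT => H; have : Rle l (l - e).
    apply: l2 => r Er; apply/RleP; rewrite leNgt; apply/negP => lr.
    by apply: H; exists r.
  by move=> /RleP; rewrite lerDl oppr_ge0 leNgt e0.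
have e2 : 0 < e / 2 by rewrite divr_gt0.
have [Ul|Ul] := in_ultra_setVsetC [set t | l + e / 2 <= a t] UU.
  have /RleP := l1 _ Ul; by rewrite gerDl leNgt e2.
apply: filterS (filterI Er Ul) => t /= [rt /negP]; rewrite -ltNge => lt.
rewrite ltr_norml; apply/andP; split.
  by rewrite ltrBrDl; apply: lt_le_trans lr rt.
rewrite ltrBlDl; apply: lt_trans lt _; rewrite ltrD2l.
by rewrite ltr_pdivrMr // ltr_pMr // ltr1n.
Qed.

(** A Tychonoff argument: choose a solution for each finite list and take limits along an
    ultrafilter refining the lists ordered by inclusion. [P] is retained only for the approximants,
    because it is not assumed closed under limits. *)
Lemma bounded_family_cluster (X : Type) (J : finType) (P : seq X -> (X -> J -> CC) -> Prop) :
  (forall s t psi, (forall x, List.In x s -> List.In x t) -> P t psi -> P s psi) ->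
  (forall s, exists2 psi, P s psi & forall x j, `|psi x j| <= 1) ->
  exists psi, forall s (e : CC), 0 < e -> exists2 psi', P s psi' &
    forall x j, List.In x s -> `|psi' x j - psi x j| < e.
Proof.
move=> mono ex.
have ex' s : exists psi : X -> J -> CC, P s psi /\ forall x j, `|psi x j| <= 1.
  by have [psi] := ex s; exists psi.
have [Psi HPsi] := boolp.choice ex'.
pose F := filter_from (@setT (seq X)) (fun s => [set t | forall x, List.In x s -> List.In x t]).
have FF : ProperFilter F.
  apply: filter_from_proper; last by move=> s _; exists s.
  apply: filter_fromT_filter; first by exists [::].
  move=> s t; exists (s ++ t) => w Hw; split => x Hx; apply: Hw; apply/List.in_or_app.
    by left.
  by right.
have [U [UU FU]] := ultraFilterLemma FF.
have lims x j : exists l : CC, forall e : CC, 0 < e -> U [set s | `|Psi s x j - l| < e].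
  have b1 s : `|Psi s x j| <= (1 : R)%:C%C by case: (HPsi s).
  have [|l1 H1] := @ultra_lim _ U (fun s => complex.Re (Psi s x j)) UU.
    by move=> s; case: (complex_norm_ge (b1 s)).
  have [|l2 H2] := @ultra_lim _ U (fun s => complex.Im (Psi s x j)) UU.
    by move=> s; case: (complex_norm_ge (b1 s)).
  exists (l1 +i* l2)%C => e e0.
  have [f Ef] : exists f, e = f%:C%C by apply/complex_realP; exact: gtr0_real.
  have f0 : 0 < f / 2 by rewrite divr_gt0 // -ltcR -Ef.
  apply: filterS (filterI (H1 _ f0) (H2 _ f0)) => s /= [h1 h2].
  have -> : e = ((f / 2) *+ 2)%:C%C by rewrite Ef mulr2n -splitr.
  by apply: complex_norm_small; case: (Psi s x j) h1 h2 => p q h1 h2; [exact: h1|exact: h2].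
have [psi Hpsi] : exists psi : X -> J -> CC, forall x j (e : CC), 0 < e ->
    U [set s | `|Psi s x j - psi x j| < e].
  have [g Hg] := boolp.choice (fun xj : X * J => lims xj.1 xj.2).
  by exists (fun x j => g (x, j)) => x j; exact: (Hg (x, j)).
exists psi => s e e0.
have Us : U [set t | forall x, List.In x s -> List.In x t] by apply: FU; exists s.
have Uc : U [set t | forall x j, List.In x s -> `|Psi t x j - psi x j| < e].
  elim: {Us} s => [|x s IH]; first by apply: (filterS _ filterT) => t _ y j [].
  have Ux : U [set t | forall j, `|Psi t x j - psi x j| < e].
    have : forall js : seq J, U [set t | forall j, j \in js -> `|Psi t x j - psi x j| < e].
      elim => [|j js IHj]; first by apply: (filterS _ filterT) => t _ j'; rewrite in_nil.
      apply: filterS (filterI (Hpsi x j e e0) IHj) => t /= [h1 h2] j'.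
      by rewrite inE => /orP[/eqP ->|/h2].
    by move=> /(_ (enum J)); apply: filterS => t /= h j; apply: h; rewrite mem_enum.
  apply: filterS (filterI Ux IH) => t /= [h1 h2] y j [<-|/h2]; [exact: h1|exact].
have [t /= [h1 h2]] := filter_ex (filterI Us Uc).
exists (Psi t) => //; apply: mono h1 _; by case: (HPsi t).
Qed.

End Compactness.

(** A family may repeat points; adding its coefficients over the fibres of x reduces it to the index
    set itself. *)
Lemma fpsd_PSD (I : finType) (T : I -> I -> CC) : fpsd T -> PSD T.
Proof.
move=> HT J x c; have := HT (fun k => \sum_(i | x i == k) c i).
congr (0 <= _); rewrite [RHS](partition_big x xpredT) //=.
apply: eq_bigr => k _; rewrite [RHS]exchange_big /= [RHS](partition_big x xpredT) //=.
apply: eq_bigr => l _; rewrite mulr_sumr mulr_suml; apply: eq_bigr => j /eqP <-.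
by rewrite rmorph_sum 2!mulr_suml; apply: eq_bigr => i /eqP <-.
Qed.

Section Leech.
Variables (X : Type) (d : nat) (b : X -> 'I_d -> CC).
Hypothesis ball : forall x, dot (b x) (b x) < 1.

Lemma psd_limit (phi : X -> CC) (M : CC) :
  (forall (I : finType) (x : I -> X) (e : CC), 0 < e -> exists2 phi' : I -> CC,
     fpsd (fun i j => (M ^+ 2 - phi' i * (phi' j)^*) * ker b (x i) (x j)) &
     forall i, `|phi' i - phi (x i)| < e) ->
  psd b (fun x y => M ^+ 2 - phi x * (phi y)^*).
Proof.
move=> H I x c.
pose D i j := `|(c i)^* * c j * ker b (x i) (x j)| * (`|phi (x i)| + `|phi (x j)| + 1).
have D0 i j : 0 <= D i j by rewrite mulr_ge0 // !addr_ge0.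
pose S := \sum_i \sum_j D i j.
have S0 : 0 <= S by apply: sumr_ge0 => i _; apply: sumr_ge0.
apply: ge0_approx => e e0.
have Se : 0 < S + 1 + e by rewrite addr_gt0 // ltr_wpDl.
(* This tolerance satisfies both f <= 1, which bounds the approximants, and f S < e. *)
pose f := e / (S + 1 + e).
have f0 : 0 < f by rewrite divr_gt0.
have f1 : f <= 1 by rewrite ler_pdivrMr // mul1r lerDr addr_ge0.
have [phi' Hp Hf] := H I x f f0.
exists (\sum_i \sum_j (c i)^* * c j * ((M ^+ 2 - phi' i * (phi' j)^*) * ker b (x i) (x j))) => //.
apply: (@le_lt_trans _ _ (f * S)); last first.
  rewrite /f mulrAC ltr_pdivrMr // ltr_pM2l // -addrA ltrDl; by rewrite addr_gt0.
rewrite -sumrB; apply: le_trans (ler_norm_sum _ _ _) _.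
rewrite mulr_sumr; apply: ler_sum => i _.
rewrite -sumrB; apply: le_trans (ler_norm_sum _ _ _) _.
rewrite mulr_sumr; apply: ler_sum => j _.
have -> : (c i)^* * c j * ((M ^+ 2 - phi (x i) * (phi (x j))^*) * ker b (x i) (x j)) -
  (c i)^* * c j * ((M ^+ 2 - phi' i * (phi' j)^*) * ker b (x i) (x j)) =
  ((c i)^* * c j * ker b (x i) (x j)) * ((phi' i - phi (x i)) * (phi' j)^*
    + phi (x i) * (phi' j - phi (x j))^*).
  rewrite rmorphB /=; ring.
rewrite /D normrM mulrCA; apply: ler_wpM2l => //.
apply: le_trans (ler_normD _ _) _; rewrite !normrM !norm_conjC.
have hj : `|phi' j| <= `|phi (x j)| + 1.
  rewrite -[phi' j](subrK (phi (x j))) addrC; apply: le_trans (ler_normD _ _) _.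
  rewrite lerD2l; apply: le_trans f1; exact: ltW.
have -> : f * (`|phi (x i)| + `|phi (x j)| + 1) = f * (`|phi (x j)| + 1) + `|phi (x i)| * f.
  ring.
apply: lerD.
  by apply: ler_pM => //; exact: ltW.
by apply: ler_wpM2l => //; exact: ltW.
Qed.

Lemma leech (u : X -> 'I_d -> CC) (phi : X -> CC) :
  psd b (fun x y => dot (u x) (u y) - phi x * (phi y)^*) ->
  exists psi : X -> 'I_d -> CC, (forall x, phi x = \sum_a u x a * psi x a) /\
    forall a, mult b (psi^~ a) 1.
Proof.
move=> Hu.
pose P (s : seq X) (psi : X -> 'I_d -> CC) :=
  (forall x, List.In x s -> phi x = \sum_a u x a * psi x a) /\
  forall a (I : finType) (x : I -> X), (forall i, List.In (x i) s) ->
    fpsd (fun i j => (1 ^+ 2 - psi (x i) a * (psi (x j) a)^*) * ker b (x i) (x j)).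
have [||psi Hpsi] := @bounded_family_cluster X 'I_d P.
- move=> s t psi st [H1 H2]; split=> [x /st /H1 //|a I x Hx].
  by apply: H2 => i; exact: st.
- move=> s; pose p := tnth (in_tuple s).
  have pin x : List.In x s -> exists k, p k = x.
    move=> xs; apply: contrapT => nk.
    have : forall s', (forall k : 'I_(size s'), tnth (in_tuple s') k <> x) -> ~ List.In x s'.
      elim => [_ []|y s' IH Hk [yx|]]; first by apply: (Hk ord0); rewrite (tnth_nth x).
      apply: IH => k kx; apply: (Hk (lift ord0 k)).
      by rewrite -[RHS]kx !(tnth_nth x).
    by move=> /(_ s); apply => // k kx; apply: nk; exists k.
  (* The list may repeat points, so an index is chosen for each of its members; the solution is
     extended by 0 off the list. *)
  have [k Hk] : exists k : X -> option 'I_(size s), forall x,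
      if k x is Some i then p i = x else ~ List.In x s.
    have := @boolp.choice X (option 'I_(size s)) (fun x o => if o is Some i then p i = x else ~ List.In x s).
    case => [x|k Hk]; last by exists k.
    have [xs|nx] := pselect (List.In x s); first by have [i Hi] := pin _ xs; exists (Some i).
    by exists None.
  have ball' i : dot (b (p i)) (b (p i)) < 1 by [].
  have [||||psi [E HE]] := @finite_leech _ (size s) d (\matrix_(i, a) b (p i) a) (\matrix_(i, a) u (p i) a)
     (phi \o p) (fun i j => ker b (p i) (p j)).
  + move=> i /=; under eq_bigr do rewrite !mxE; exact: ball.
  + move=> i j /=; under eq_bigr do rewrite !mxE; exact: kerK.
  + by move=> i j; exact: kerC.
  + move=> c; have := Hu _ p c; congr (0 <= _); apply: eq_bigr => i _; apply: eq_bigr => j _.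
    congr (_ * _); congr (( _ - _) * _); by apply: eq_bigr => a _; rewrite !mxE.
  (* 1 - psi psi^* is a positive kernel plus a Gram kernel times 1 - <b, b>. Multiplication by the
     kernel keeps the first positive and turns the second into the Gram kernel. *)
  have Hm a : mult (b \o p) (psi^~ a) 1.
    split=> //; have [h [T HT HE']] := HE a.
    have Hh : psd (b \o p) (fun k l => (\sum_j h k j * (h l j)^*) * (1 - dot (b (p k)) (b (p l)))).
      apply: PSD_ext (PSD_sum (fun j => PSD_rank1 (h^~ j))) => i l.
      by rewrite -mulrA [_ * ker _ _ _]mulrC kerK // mulr1.
    apply: psd_ext (psd_add (PSD_psd ball' (fpsd_PSD HT)) Hh) => i j.
    rewrite expr1n HE'; congr (_ + _ * (1 - _)).
    by apply: eq_bigr => e _; rewrite !mxE.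
  exists (fun x a => if k x is Some i then psi i a else 0).
    split=> [x xs|a I x Hx].
      have := Hk x; case: (k x) => // i <-; rewrite -[phi _]/((phi \o p) i) E.
      by apply: eq_bigr => a _; rewrite !mxE.
    have [kx Hkx] : exists kx : I -> 'I_(size s), forall i, k (x i) = Some (kx i).
      have := @boolp.choice I 'I_(size s) (fun i m => k (x i) = Some m).
      case => [i|kx]; last by exists kx.
      by have := Hk (x i); case: (k (x i)) => [m|//]; exists m.
    have [_ H] := Hm a; move=> c; have := H I kx c; congr (0 <= _).
    apply: eq_bigr => i _; apply: eq_bigr => j _; rewrite !Hkx.
    have pE m : p (kx m) = x m by have := Hk (x m); rewrite Hkx.
    by rewrite /ker /= !pE.
  move=> x a; case: (k x) => [i|]; last by rewrite normr0.
  exact: (mult_bound ball' i (Hm a)).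
exists psi; split=> [x|a].
  apply/eqP; rewrite -subr_eq0 -normr_eq0; apply/negP => /negP n0.
  set D := `|_| in n0; have D0 : 0 < D by rewrite lt_neqAle eq_sym n0 normr_ge0.
  pose S := \sum_a `|u x a|; have S0 : 0 <= S by apply: sumr_ge0.
  have S1 : 0 < S + 1 by rewrite ltr_wpDl.
  have f0 : 0 < D / (S + 1) by rewrite divr_gt0.
  have [psi' [H1 _] H2] := Hpsi [:: x] _ f0.
  have : D <= S * (D / (S + 1)).
    rewrite {1}/D (H1 x); last by left.
    rewrite -sumrB mulr_suml; apply: le_trans (ler_norm_sum _ _ _) _.
    apply: ler_sum => a _; rewrite -mulrBr normrM; apply: ler_wpM2l => //.
    by apply: ltW; apply: H2; left.
  rewrite mulrA ler_pdivlMr // mulrDr mulr1 mulrC gerDl.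
  by move=> /(lt_le_trans D0); rewrite ltxx.
split=> //; apply: psd_limit => I x e e0.
have [psi' [_ H1] H2] := Hpsi [seq x i | i <- enum I] e e0.
have xin i : List.In (x i) [seq x i | i <- enum I].
  by apply: List.in_map; apply: in_List; rewrite mem_enum.
exists (fun i => psi' (x i) a); first exact: H1.
by move=> i; apply: H2.
Qed.

End Leech.

(** * Gleason's problem *)

Section Gleason.
Variables (X : Type) (d : nat) (b : X -> 'I_d -> CC).
Hypothesis ball : forall x, dot (b x) (b x) < 1.

(* The Schur complement at x0 gives M^2 <theta(x), theta(y)> - phi phi^* >= 0 (times the kernel) for the
   ball automorphism theta vanishing at b x0; Lagrange's identity then bounds <theta(x), theta(y)>
   by <b x - b x0, b y - b x0> up to the factors ker b x x0. *)
Lemma gleason_leech x0 (phi : X -> CC) (M : CC) : 0 < M -> mult b phi M -> phi x0 = 0 ->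
  exists psi : X -> 'I_d -> CC,
    (forall x, phi x = \sum_a (M * ker b x x0 * (b x a - b x0 a)) * psi x a) /\
    forall a, mult b (psi^~ a) 1.
Proof.
move=> M0 [_ Hphi] phi0; apply: leech => //.
set l := b x0; set e := fun x => ker b x x0.
have Mr : M^* = M by rewrite geC0_conj // ltW.
have Mn : M != 0 by rewrite gt_eqF.
have eC y : ker b x0 y = (e y)^* by rewrite kerC.
have H1 : psd b (fun x y => M ^+ 2 - phi x * (phi y)^* -
    M ^+ 2 * (e x * (e y)^* * ((1 - dot l l) * (1 - dot (b x) (b y))))).
  have A0 y : M ^+ 2 - phi x0 * (phi y)^* = M ^+ 2 by rewrite phi0 mul0r subr0.
  have A1 x : M ^+ 2 - phi x * (phi x0)^* = M ^+ 2 by rewrite phi0 rmorph0 mulr0 subr0.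
  apply: PSD_ext (PSD_schur _ (x0 := x0) _ Hphi) => [x y|x y|]; last first.
  - by rewrite A0 mulr_gt0 ?exprn_gt0 ?ker_gt0.
  - by rewrite rmorphM rmorphB rmorphXn rmorphM /= conjCK kerC Mr [_^* * _]mulrC.
  rewrite !A0 A1 eC.
  have K1 := kerK ball x y; have K0 := kerK ball x0 x0.
  rewrite -/l in K0; rewrite [RHS]mulrBl; congr (_ - _).
  have kn := ker_neq0 ball x0 x0.
  have -> : (1 - dot l l) = (ker b x0 x0)^-1 by rewrite /ker invrK.
  transitivity (M ^+ 2 * (e x * (e y)^* / ker b x0 x0)); first by rewrite /e; field; rewrite kn Mn.
  rewrite -!mulrA; do 3 congr (_ * _).
  by rewrite [_ * ker _ _ _]mulrC K1 mulr1.
have H2 : psd b (fun x y => (M * e x) * (dot l l * dot (b x) (b y) - dot (b x) l * dot l (b y)) * (M * e y)^*).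
  apply: psd_congr; apply: PSD_psd => //; have h0 : 0 <= 2%:R^-1 :> CC by rewrite invr_ge0.
  apply: PSD_ext (PSD_scale h0 (PSD_sum (fun i => PSD_sum (fun j =>
    PSD_rank1 (fun x => b x i * l j - b x j * l i))))) => x y.
  by rewrite dot_lagrange.
(* The identity behind the sum is (1 - <x,l>)(1 - <l,y>) - (1 - |l|^2)(1 - <x,y>) + |l|^2 <x,y> -
   <x,l><l,y> = <x - l, y - l>. *)
apply: psd_ext (psd_add H1 H2) => x y.
have -> : dot (fun a => M * e x * (b x a - l a)) (fun a => M * e y * (b y a - l a)) =
   M ^+ 2 * (e x * (e y)^*) * (dot (b x) (b y) - dot (b x) l - dot l (b y) + dot l l).
  rewrite /dot -!sumrB -big_split /= mulr_sumr; apply: eq_bigr => a _.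
  rewrite !rmorphM rmorphB /= Mr; ring.
have E1 : e x * (1 - dot (b x) l) = 1 by exact: kerK.
have E2 : (e y)^* * (1 - dot l (b y)) = 1 by rewrite -eC kerK.
have -> : M ^+ 2 - phi x * (phi y)^* = M ^+ 2 * ((e x * (1 - dot (b x) l)) * ((e y)^* * (1 - dot l (b y)))) - phi x * (phi y)^*.
  by rewrite E1 E2 !mulr1.
rewrite rmorphM /= Mr; ring.
Qed.

(** The factor [ker b x x0] = (1 - <b x, b x0>)^-1 is itself a multiplier, being a resolvent at z =
    1, and is absorbed into psi. The constant depends on x0 alone; its factor 2 comes from
    subtracting phi(x0). *)
Lemma gleason x0 : exists2 c : CC, 0 < c & forall phi (M : CC), 0 < M -> mult b phi M ->
  exists psi : X -> 'I_d -> CC,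
    (forall x, phi x - phi x0 = \sum_a (b x a - b x0 a) * psi x a) /\
    forall a, mult b (psi^~ a) (c * M).
Proof.
pose l := b x0; pose s := sqrtC (dot l l).
have s0 : 0 <= s by rewrite sqrtC_ge0 dot_ge0.
have s1 : s < 1.
  by rewrite -(@ltr_pXn2r _ 2) ?nnegrE // expr1n sqrtCK; exact: ball.
(* A bound strictly between 0 and 1 even when s = 0, since the resolvent estimate divides by it. *)
pose t := (s + 1) / 2%:R.
have t0 : 0 < t by rewrite divr_gt0 // ltr_wpDl.
have st : s <= t by rewrite ler_pdivlMr // mulr_natr mulr2n lerD2l ltW.
have t1 : t < `|1| by rewrite normr1 ltr_pdivrMr // mul1r -[2%:R]/(1 + 1) ltrD2r.
have Hl : mult b (fun x => dot (b x) l) t.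
  by apply: (mult_le _ st) => //; apply: mult_dot => //; rewrite sqrtCK.
have [_ He] := mult_resolvent ball t0 t1 Hl.
have c0 : 0 < (`|1| - t)^-1 by rewrite invr_gt0 subr_gt0.
exists ((`|1| - t)^-1 * 2%:R) => [|phi M M0 Hphi]; first by rewrite mulr_gt0.
have H' : mult b (fun x => phi x - phi x0) (2%:R * M).
  have Hc : mult b (fun _ => - phi x0) M.
    have := mult_cst ball (- phi x0); apply: mult_le => //.
    by rewrite normrN; exact: mult_bound Hphi.
  by have := multD ball M0 M0 Hphi Hc; rewrite -mulr2n mulr_natl.
have M2 : 0 < 2%:R * M by rewrite mulr_gt0.
have [psi [E Hpsi]] := @gleason_leech x0 _ _ M2 H' (subrr _).
exists (fun x a => (2%:R * M) * (ker b x x0 * psi x a)); split=> [x|a].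
  rewrite E; apply: eq_bigr => a _; ring.
have := multZ ball (2%:R * M) (multM He (Hpsi a)).
by rewrite ger0_norm ?(ltW M2) // mulr1 [2%:R * M * _]mulrC mulrA.
Qed.

(** Equicontinuity: the constant is uniform over all multipliers of norm at most M, which is what
    the Cesaro means require. *)
Lemma mult_lip x0 : exists2 c : CC, 0 < c & forall phi (M : CC), 0 < M -> mult b phi M ->
  forall x, `|phi x - phi x0| <= c * M * \sum_a `|b x a - b x0 a|.
Proof.
have [c c0 H] := gleason x0; exists c => // phi M M0 Hphi x.
have [psi [E Hpsi]] := H _ _ M0 Hphi; rewrite E.
apply: le_trans (ler_norm_sum _ _ _) _; rewrite mulr_sumr; apply: ler_sum => a _.
rewrite normrM mulrC; apply: ler_wpM2r => //; exact: mult_bound (Hpsi a).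
Qed.

End Gleason.

(** A substitute for a maximiser, which need not exist: an element above both [A] and three quarters
    of the supremum. *)
Lemma near_max (E : CC -> Prop) (A a k : CC) : (forall e, E e -> 0 <= e <= k) ->
  0 <= A -> E a -> A < a ->
  exists2 e, E e & A < e /\ forall e', E e' -> 3%:R * e' <= 4%:R * e.
Proof.
move=> HE A0 Ea Aa.
have toR e : E e -> e = (complex.Re e)%:C%C.
  by move=> /HE /andP[e0 _]; rewrite RRe_real // ger0_real.
have AR : A = (complex.Re A)%:C%C by rewrite RRe_real // ger0_real.
have kR : k = (complex.Re k)%:C%C.
  by rewrite RRe_real // ger0_real //; have /andP[h1 h2] := HE _ Ea; apply: le_trans h2.
pose F (r : R) := E (r%:C%C).
have Fa : F (complex.Re a) by rewrite /F -toR.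
have [||l [l1 l2]] := completeness F.
- exists (complex.Re k) => r Fr; apply/RleP; rewrite -lecR -kR.
  by have /andP[] := HE _ Fr.
- by exists (complex.Re a).
have al : complex.Re a <= l by apply/RleP/l1.
have Al : complex.Re A < l by apply: lt_le_trans al; rewrite -ltcR -AR -toR.
have A0' : 0 <= complex.Re A by rewrite -ler0c -AR.
have l0 : 0 < l by apply: le_lt_trans Al.
pose m := Num.max (complex.Re A) (3%:R / 4%:R * l).
have ml : m < l.
  rewrite /m gt_max Al /= mulrC gtr_pMr // ltr_pdivrMr // mul1r ltr_nat //.
have [r Fr mr] : exists2 r, F r & m < r.
  apply: contrapT => H; have : Rle l m.
    apply: l2 => r Fr; apply/RleP; rewrite leNgt; apply/negP => mr.
    by apply: H; exists r.
  by move=> /RleP; rewrite leNgt ml.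
move: mr; rewrite /m gt_max => /andP[Ar lr].
exists (r%:C%C) => //; split; first by rewrite AR ltcR.
move=> e' Ee'; rewrite (toR _ Ee').
have el : complex.Re e' <= l by apply/RleP/l1; rewrite /F -toR.
rewrite -!(rmorph_nat (real_complex R)) -!rmorphM lecR.
apply: (@le_trans _ _ (3%:R * l)); first by rewrite ler_pM2l // ltr0n.
apply: ltW; move: lr; rewrite mulrAC ltr_pdivrMr ?ltr0n //.
by rewrite [r * _]mulrC.
Qed.

(** * Squared seminorms given by finite tests *)

Section Quadratic.
Variables (X : Type) (d : nat) (b : X -> 'I_d -> CC).
Hypothesis ball : forall x, dot (b x) (b x) < 1.

Definition test := {I : finType & ((I -> X) * (I -> CC))%type}.

(** For f = sum_j c_j k_(x_j) this is the squared norm of M_r^* f. As a squared seminorm in r it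
    obeys the parallelogram law. *)
Definition quad (v : test) (r : X -> CC) : CC :=
  let x := (projT2 v).1 in let c := (projT2 v).2 in
  \sum_i \sum_j (c i)^* * c j * (r (x i) * (r (x j))^* * ker b (x i) (x j)).

Lemma quad_ge0 v r : 0 <= quad v r.
Proof. exact: (psd_rank1 ball r). Qed.

Lemma quad_par v r s : quad v (fun x => r x + s x) + quad v (fun x => r x - s x) =
  2%:R * quad v r + 2%:R * quad v s.
Proof.
rewrite /quad !mulr_sumr -!big_split; apply: eq_bigr => i _ /=.
rewrite !mulr_sumr -!big_split; apply: eq_bigr => j _ /=.
rewrite rmorphD rmorphB /=; ring.
Qed.

Lemma quadZ v a r : quad v (fun x => a * r x) = `|a| ^+ 2 * quad v r.
Proof.
rewrite /quad mulr_sumr; apply: eq_bigr => i _.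
rewrite mulr_sumr; apply: eq_bigr => j _; rewrite rmorphM /= normCK; ring.
Qed.

Lemma quad_add_le v r s : quad v (fun x => r x + s x) <= 2%:R * quad v r + 2%:R * quad v s.
Proof. by rewrite -quad_par lerDl quad_ge0. Qed.

(** For a fixed test the bound is finite and independent of r, so pointwise contractivity gives
    finite suprema. *)
Lemma quad_bound v r : (forall x, `|r x| <= 1) ->
  quad v r <= \sum_i \sum_j `|((projT2 v).2 i)^* * (projT2 v).2 j *
     ker b ((projT2 v).1 i) ((projT2 v).1 j)|.
Proof.
move=> r1; rewrite -[quad v r]ger0_norm ?quad_ge0 //.
apply: le_trans (ler_norm_sum _ _ _) _; apply: ler_sum => i _.
apply: le_trans (ler_norm_sum _ _ _) _; apply: ler_sum => j _.
rewrite !normrM mulrA [X in X * _]mulrA -[X in _ <= X]mulr1 -!mulrA.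
do 2 (apply: ler_wpM2l => //).
rewrite mulrA mulrC; apply: ler_wpM2l => //.
by rewrite norm_conjC mulr_ile1.
Qed.

Lemma mult_quad r M v : mult b r M -> quad v r <= M ^+ 2 * quad v (fun _ => 1).
Proof.
move=> [M0 H]; rewrite -subr_ge0; have := H _ (projT2 v).1 (projT2 v).2.
congr (0 <= _); rewrite /quad mulr_sumr -sumrB; apply: eq_bigr => i _.
rewrite mulr_sumr -sumrB; apply: eq_bigr => j _; rewrite rmorph1; ring.
Qed.

Lemma quad_mult r M : 0 <= M ->
  (forall v, quad v r <= M ^+ 2 * quad v (fun _ => 1)) -> mult b r M.
Proof.
move=> M0 H; split=> // I x c.
have := H (existT (fun I : finType => ((I -> X) * (I -> CC))%type) I (x, c)).
rewrite -subr_ge0; congr (0 <= _); rewrite /quad mulr_sumr -sumrB /=; apply: eq_bigr => i _.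
rewrite mulr_sumr -sumrB; apply: eq_bigr => j _; rewrite rmorph1; ring.
Qed.

End Quadratic.

(** * Uniform boundedness *)

Lemma archimedeanC (x : CC) : 0 <= x -> exists n : nat, x < n%:R.
Proof.
move=> x0; have [m Em] : exists m, x = m%:C%C by apply/complex_realP; exact: ger0_real.
exists (Num.Def.archi_bound m); rewrite Em -(rmorph_nat (real_complex R)) ltcR.
by apply: archi_boundP; rewrite -ler0c -Em.
Qed.

Definition ismult (X : Type) (d : nat) (b : X -> 'I_d -> CC) (p : X -> CC) : Prop :=
  exists M, mult b p M.

Lemma ismult_pos (X : Type) (d : nat) (b : X -> 'I_d -> CC) p :
  (forall x, dot (b x) (b x) < 1) -> ismult b p -> exists2 M : CC, 0 < M & mult b p M.
Proof.
move=> ball [M H]; have M0 : 0 <= M by case: H.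
exists (M + 1); first by rewrite ltr_wpDl.
by apply: mult_le H => //; rewrite lerDl.
Qed.

Lemma ismult_lin (X : Type) (d : nat) (b : X -> 'I_d -> CC) (a : CC) p q :
  (forall x, dot (b x) (b x) < 1) -> ismult b p -> ismult b q ->
  ismult b (fun x => a * p x + q x).
Proof.
move=> ball Hp /(ismult_pos ball) [N N0 Hq].
have [M M0 Hp'] : exists2 M, 0 < M & mult b (fun x => a * p x) M.
  apply: ismult_pos => //; have [M H] := Hp; exists (`|a| * M); exact: multZ.
by exists (M + N); exact: multD.
Qed.

Section UniformBoundedness.
Variables (X1 X2 : Type) (d1 d2 : nat) (b1 : X1 -> 'I_d1 -> CC) (b2 : X2 -> 'I_d2 -> CC).
Hypothesis ball1 : forall x, dot (b1 x) (b1 x) < 1.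
Hypothesis ball2 : forall x, dot (b2 x) (b2 x) < 1.
Variable T : (X1 -> CC) -> (X2 -> CC).
Hypothesis T_lin : forall (a : CC) p q, ismult b1 p -> ismult b1 q ->
  T (fun x => a * p x + q x) = (fun y => a * T p y + T q y).
Hypothesis T_mult : forall p, ismult b1 p -> ismult b2 (T p).
Hypothesis T_contr : forall p (M : CC) y, 0 < M -> mult b1 p M -> `|T p y| <= M.

Lemma linear_scale (a : CC) p : ismult b1 p -> T (fun x => a * p x) = fun y => a * T p y.
Proof.
have z0 : ismult b1 (fun _ => 0) by exists `|0 : CC|; exact: mult_cst.
have T0 : T (fun _ => 0) = fun _ => 0.
  have := T_lin 1 z0 z0; rewrite (_ : (fun _ => 1 * 0 + 0) = (fun _ => 0)); last first.
    by apply: funext => x; rewrite mul1r addr0.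
  move=> E; apply: funext => y; have /eqP := congr1 (fun f => f y) E.
  by rewrite /= mul1r eq_sym addrC -subr_eq0 addrK => /eqP.
move=> Hp; have := T_lin a Hp z0; rewrite T0.
have -> : (fun x => a * p x + 0) = (fun x => a * p x).
  by apply: funext => x; rewrite addr0.
by move=> ->; apply: funext => y; rewrite addr0.
Qed.

(** With ratio 1/3 the steps after the n-th one add up to half of it, so the remaining tail cannot
    cancel the n-th hump. *)
Local Notation lam n := (3%:R^-1 ^+ n.+1 : CC).

(* Sokal's form of the gliding hump.  No completeness is needed: multipliers of norm at most M are
   closed under pointwise limits. *)
Section Hump.
Variables (v : nat -> test X2) (q : nat -> X1 -> CC).
Hypothesis q1 : forall n, mult b1 (q n) 1.
Hypothesis qmax : forall n p, mult b1 p 1 ->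
  3%:R * quad b2 (v n) (T p) <= 4%:R * quad b2 (v n) (T (q n)).
(** The final estimate bounds the right-hand side by 6 * 9^(n+1) times the test of the limit:
    9^(n+1) is lam_n^(-2), 6 is the loss from the tail, and n^2 dominates the squared norm of the
    limit's image. *)
Hypothesis qbig : forall n,
  6%:R * 9%:R ^+ n.+1 * n%:R ^+ 2 * quad b2 (v n) (fun _ => 1) < quad b2 (v n) (T (q n)).

(* The sign is chosen so that the n-th test sees at least the n-th increment. *)
Fixpoint hump (n : nat) : X1 -> CC :=
  if n is m.+1 then
    let p := fun x => lam m * q m x + hump m x in
    if quad b2 (v m) (fun y => lam m * T (q m) y) <= quad b2 (v m) (T p) then p
    else fun x => - lam m * q m x + hump m x
  else fun _ => 0.

Lemma lam_gt0 n : 0 < lam n.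
Proof. by rewrite exprn_gt0 // invr_gt0. Qed.

Lemma hump_step n : exists2 e : CC, `|e| = lam n &
  hump n.+1 = fun x => e * q n x + hump n x.
Proof.
rewrite /=; case: ifP => _; [exists (lam n)|exists (- lam n)] => //.
  by rewrite ger0_norm // ltW // lam_gt0.
by rewrite normrN ger0_norm // ltW // lam_gt0.
Qed.

Lemma hump_diff n k : mult b1 (fun x => hump (n + k) x - hump n x) (2%:R^-1 * 3%:R^-1 ^+ n).
Proof.
have P k' : 0 < 2%:R^-1 * 3%:R^-1 ^+ n * (1 - 3%:R^-1 ^+ k'.+1) :> CC.
  rewrite !mulr_gt0 ?exprn_gt0 ?invr_gt0 // subr_gt0 exprn_ilt1 ?invr_ge0 //.
  by rewrite invf_lt1 ?ltr1n.
(* [multD] needs positive bounds, so the induction carries the exact geometric sum over k + 1 steps;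
   the rounded bound covers the empty sum k = 0. *)
suff H : mult b1 (fun x => hump (n + k.+1) x - hump n x)
    (2%:R^-1 * 3%:R^-1 ^+ n * (1 - 3%:R^-1 ^+ k.+1)) /\
   mult b1 (fun x => hump (n + k) x - hump n x) (2%:R^-1 * 3%:R^-1 ^+ n).
  by case: H.
elim: k => [|k [IH _]].
  split.
    have [e e1 ->] : exists2 e : CC, `|e| = lam n & (fun x => hump (n + 1) x - hump n x) = fun x => e * q n x.
      have [e e1 E] := hump_step n; exists e => //.
      by rewrite addn1 E; apply: funext => x; rewrite addrK.
    have := multZ ball1 e (q1 n); rewrite e1 mulr1.
    by have -> : 2%:R^-1 * 3%:R^-1 ^+ n * (1 - 3%:R^-1 ^+ 1) = lam n :> CC by rewrite expr1 exprS; field.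
  apply: mult_ext (mult_le _ _ (mult_cst ball1 0)) => //.
    by move=> x; rewrite addn0 subrr.
  by rewrite normr0 mulr_ge0 ?invr_ge0 // exprn_ge0 // invr_ge0.
have IH2 : mult b1 (fun x => hump (n + k.+1) x - hump n x) (2%:R^-1 * 3%:R^-1 ^+ n).
  apply: mult_le IH => //; rewrite ger_pMr; last by rewrite mulr_gt0 ?exprn_gt0 ?invr_gt0.
  by rewrite gerBl exprn_ge0 // invr_ge0.
split=> //; have [e e1 E] := hump_step (n + k.+1).
have := multD ball1 (P k) (lam_gt0 (n + k.+1)) IH.
have := multZ ball1 e (q1 (n + k.+1)); rewrite e1 mulr1 => He /(_ _ He).
have -> : 2%:R^-1 * 3%:R^-1 ^+ n * (1 - 3%:R^-1 ^+ k.+1) + lam (n + k.+1) =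
   2%:R^-1 * 3%:R^-1 ^+ n * (1 - 3%:R^-1 ^+ k.+2) :> CC.
  rewrite !(exprS, exprD); by field.
apply: mult_ext => x; rewrite (addnS n k.+1) E; ring.
Qed.

Lemma ismult_hump n : ismult b1 (hump n).
Proof.
exists (2%:R^-1 * 3%:R^-1 ^+ 0); apply: mult_ext (hump_diff 0 n) => x.
by rewrite add0n subr0.
Qed.

(** By the parallelogram law the values for the two signs add up to at least twice that of the
    increment; if the plus sign fails, the minus sign works. *)
Lemma hump_big n : lam n ^+ 2 * quad b2 (v n) (T (q n)) <= quad b2 (v n) (T (hump n.+1)).
Proof.
have Hl : `|lam n| = lam n by rewrite ger0_norm // ltW // lam_gt0.
have Hq : ismult b1 (q n) by exists 1.
have Hh := ismult_hump n.
rewrite -{1}Hl -quadZ /=; case: ifPn => [//|].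
set A := quad _ _ _; rewrite (T_lin (lam n) Hq Hh) (T_lin (- lam n) Hq Hh).
have par := quad_par b2 (v n) (T (hump n)) (fun y => lam n * T (q n) y).
rewrite -/A in par.
have -> : (fun y => lam n * T (q n) y + T (hump n) y) = (fun y => T (hump n) y + lam n * T (q n) y).
  by apply: funext => y; rewrite addrC.
have -> : (fun y => - lam n * T (q n) y + T (hump n) y) = (fun y => T (hump n) y - lam n * T (q n) y).
  by apply: funext => y; rewrite addrC mulNr.
move: par; set B := quad _ _ _; set D := quad _ _ _; set F := quad _ _ _ => par.
have r x : quad b2 (v n) x \is Num.real by rewrite ger0_real // quad_ge0.
have F0 : 0 <= F by exact: quad_ge0.
rewrite -real_ltNge ?r // => BA; rewrite -(lerD2l B) par.
apply: le_trans (_ : A + A <= _); first by rewrite lerD2r ltW.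
by rewrite [_ * A]mulr_natl [A *+ 2]mulr2n lerDr mulr_ge0.
Qed.

Lemma no_hump : False.
Proof.
have hb m x : `|hump m x| <= 1.
  have := mult_bound ball1 x (hump_diff 0 m); rewrite add0n subr0 expr0 mulr1.
  by move=> h; apply: le_trans h _; rewrite invf_le1 // ler1n.
(* The summand [nat] forces the index m to be large along the cluster. *)
pose P (s : seq (X1 + nat)) (psi : X1 + nat -> unit -> CC) := exists m,
  (forall n, List.In (inr n) s -> (n <= m)%N) /\ forall x, psi (inl x) tt = hump m x.
have [||psi Hpsi] := @bounded_family_cluster (X1 + nat) unit P.
- move=> s t psi st [m [H1 H2]]; exists m; split=> // n /st; exact: H1.
- move=> s.
  have [m Hm] : exists m, forall n, List.In (inr n) s -> (n <= m)%N.
    elim: s => [|y s [m Hm]]; first by exists 0%N.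
    exists (maxn m (if y is inr n then n else 0%N)) => n [->|/Hm h].
      exact: leq_maxr.
    exact: leq_trans h (leq_maxl _ _).
  exists (fun y _ => if y is inl x then hump m x else 0); first by exists m.
  by move=> [x|k] _; rewrite ?normr0.
pose p x := psi (inl x) tt.
have Hp n : mult b1 (fun x => p x - hump n x) (2%:R^-1 * 3%:R^-1 ^+ n).
  split; first by rewrite mulr_ge0 ?invr_ge0 // exprn_ge0 // invr_ge0.
  apply: psd_limit => I x e e0.
  have [psi' [m [H1 H2]] H3] := Hpsi (inr n :: [seq inl (x i) | i <- enum I]) e e0.
  have nm : (n <= m)%N by apply: H1; left.
  exists (fun i => hump m (x i) - hump n (x i)).
    by have [_ H] := hump_diff n (m - n); move=> c; have := H I x c; rewrite subnKC.
  move=> i; rewrite opprB addrA subrK -H2; apply: H3; right.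
  apply: (List.in_map (fun i => inl (x i))); apply: in_List; by rewrite mem_enum.
have pm n : ismult b1 (fun x => p x - hump n x) by exists (2%:R^-1 * 3%:R^-1 ^+ n).
have ip : ismult b1 p.
  have [M H] := pm 0%N; exists M; apply: mult_ext H => x; exact: subr0.
have [M M0 HM] := ismult_pos ball2 (T_mult ip).
(* The stage is chosen after the limit p is known, so that n exceeds the norm of T p. *)
have [n /ltW Mn] := archimedeanC (ltW M0).
set s := quad b2 (v n) (T (q n)).
have Q1 := hump_big n; rewrite -/s in Q1.
have TE : T (hump n.+1) = fun y => T p y + -1 * T (fun x => p x - hump n.+1 x) y.
  have := T_lin (-1) (pm n.+1) ip.
  have -> : (fun x => -1 * (p x - hump n.+1 x) + p x) = hump n.+1.
    by apply: funext => x; ring.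
  by move=> ->; apply: funext => y; rewrite addrC.
have Q2 := quad_add_le ball2 (v n) (T p) (fun y => -1 * T (fun x => p x - hump n.+1 x) y).
rewrite -TE quadZ normrN normr1 expr1n mul1r in Q2.
set w := quad b2 (v n) (T (fun x => p x - hump n.+1 x)) in Q2.
pose h : CC := 2%:R^-1 * 3%:R^-1 ^+ n.+1.
have h0 : 0 < h by rewrite mulr_gt0 ?exprn_gt0 ?invr_gt0.
(* The tail divided by its bound h competes with [q n], which is maximal up to the factor 4/3. As 4
   h^2 = lam_n^2, the tail contributes at most a third of lam_n^2 s. *)
have Q3 : 3%:R * w <= 4%:R * h ^+ 2 * s.
  have Hs : mult b1 (fun x => h^-1 * (p x - hump n.+1 x)) 1.
    have := multZ ball1 h^-1 (Hp n.+1); rewrite -/h ger0_norm ?invr_ge0 ?(ltW h0) //.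
    by rewrite mulVf ?gt_eqF.
  have := qmax n Hs.
  rewrite linear_scale // quadZ ger0_norm ?invr_ge0 ?(ltW h0) // -/w -/s exprVn.
  rewrite mulrCA ler_pdivrMl ?exprn_gt0 // => H; apply: le_trans H _.
  by rewrite mulrCA mulrA.
have Q4 := mult_quad (v n) HM.
set c := quad b2 (v n) (fun _ => 1) in Q4.
have c0 : 0 <= c by exact: quad_ge0.
have Q5 := qbig n; rewrite -/s -/c in Q5.
set t := quad b2 (v n) (T p) in Q4 Q2.
have Q6 : M ^+ 2 * c <= n%:R ^+ 2 * c.
  by apply: ler_wpM2r => //; rewrite lerXn2r // nnegrE // ltW.
have l2 : lam n ^+ 2 = (9%:R ^+ n.+1)^-1.
  by rewrite -exprM mulnC exprM exprVn -natrX exprVn.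
have h2 : 4%:R * h ^+ 2 = lam n ^+ 2 by rewrite /h exprMn; field.
have H1 : lam n ^+ 2 * s <= 6%:R * t.
  rewrite h2 in Q3.
  (* From lam_n^2 s <= 2 t + 2 w and 3 w <= lam_n^2 s; subtracting the tail term leaves lam_n^2 s <=
     6 t. *)
  have H : 3%:R * (lam n ^+ 2 * s) <= 6%:R * t + 2%:R * (lam n ^+ 2 * s).
    apply: (@le_trans _ _ (3%:R * (2%:R * t + 2%:R * w))).
      by rewrite ler_pM2l // (le_trans Q1).
    rewrite mulrDr mulrA -natrM lerD2l mulrCA ler_pM2l //.
  rewrite -(lerD2r (2%:R * (lam n ^+ 2 * s))); apply: le_trans H.
  by rewrite le_eqVlt; apply/orP; left; apply/eqP; ring.
have H2 : s <= 9%:R ^+ n.+1 * (6%:R * (n%:R ^+ 2 * c)).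
  rewrite -ler_pdivrMl ?exprn_gt0 // -l2; apply: le_trans H1 _.
  rewrite ler_pM2l //; exact: le_trans Q4 Q6.
have := lt_le_trans Q5 H2.
rewrite (_ : _ * c = 9%:R ^+ n.+1 * (6%:R * (n%:R ^+ 2 * c))); last by ring.
by rewrite ltxx.
Qed.

End Hump.

Lemma uniform_boundedness : exists2 C : CC, 0 < C & forall p (M : CC), 0 < M -> mult b1 p M ->
  mult b2 (T p) (C * M).
Proof.
apply: contrapT => H.
have step n : exists vq : test X2 * (X1 -> CC), [/\ mult b1 vq.2 1,
   (forall p, mult b1 p 1 -> 3%:R * quad b2 vq.1 (T p) <= 4%:R * quad b2 vq.1 (T vq.2)) &
   6%:R * 9%:R ^+ n.+1 * n%:R ^+ 2 * quad b2 vq.1 (fun _ => 1) < quad b2 vq.1 (T vq.2)].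
  (* The summand 1 gives B <= B^2, so exceeding B^2 implies the growth required of the hump. *)
  pose B : CC := 6%:R * 9%:R ^+ n.+1 * n%:R ^+ 2 + 1.
  have B1 : 1 <= B by rewrite lerDr !mulr_ge0 ?exprn_ge0.
  have B0 : 0 < B by apply: lt_le_trans B1.
  have [p Hp nm] : exists2 p, mult b1 p 1 & ~ mult b2 (T p) B.
    apply: contrapT => K; apply: H; exists B => // p M M0 Hp.
    have Hs : mult b1 (fun x => M^-1 * p x) 1.
      have := multZ ball1 M^-1 Hp; rewrite ger0_norm ?invr_ge0 ?(ltW M0) //.
      by rewrite mulVf ?gt_eqF.
    have : mult b2 (T (fun x => M^-1 * p x)) B.
      by apply: contrapT => nm; apply: K; exists (fun x => M^-1 * p x).
    have ip : ismult b1 p by exists M.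
    rewrite (linear_scale _ ip) => /(multZ ball2 M); rewrite ger0_norm ?(ltW M0) // mulrC.
    by apply: mult_ext => y; rewrite mulVKf // gt_eqF.
  have [v Hv] : exists v, ~ (quad b2 v (T p) <= B ^+ 2 * quad b2 v (fun _ => 1)).
    apply: contrapT => K; apply: nm; apply: quad_mult; first exact: ltW.
    by move=> v; apply: contrapT => nv; apply: K; exists v.
  have r f : quad b2 v f \is Num.real by rewrite ger0_real // quad_ge0.
  have c0 : 0 <= quad b2 v (fun _ => 1) by exact: quad_ge0.
  have Hv' : B ^+ 2 * quad b2 v (fun _ => 1) < quad b2 v (T p).
    rewrite real_ltNge ?r //; first exact/negP.
    by rewrite realM // ?r // realX // ger0_real // ltW.
  (* The test witnessing failure is kept, and p is replaced by a near maximiser for this test. *)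
  have [||||e [p' Hp' ->] [Ae He]] := @near_max
     (fun e => exists2 p, mult b1 p 1 & e = quad b2 v (T p))
     (B ^+ 2 * quad b2 v (fun _ => 1)) (quad b2 v (T p))
     (\sum_i \sum_j `|((projT2 v).2 i)^* * (projT2 v).2 j *
     ker b2 ((projT2 v).1 i) ((projT2 v).1 j)|).
  - move=> _ [p' Hp' ->]; rewrite quad_ge0 //=; apply: quad_bound => // y.
    exact: T_contr Hp'.
  - by rewrite mulr_ge0 // exprn_ge0 // ltW.
  - by exists p.
  - exact: Hv'.
  exists (v, p'); split=> //=.
    by move=> p2 Hp2; apply: He; exists p2.
  apply: le_lt_trans Ae; apply: ler_wpM2r => //.
  apply: (@le_trans _ _ B); first by rewrite lerDl.
  by rewrite expr2 ler_peMr // ltW.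
have [vq Hvq] := boolp.choice step.
apply: (@no_hump (fun n => (vq n).1) (fun n => (vq n).2)) => n; by case: (Hvq n).
Qed.

End UniformBoundedness.

(** * Homomorphisms of multiplier algebras *)

(** (z - 1) times the geometric sum is z^(n+1) - 1, of modulus at most 2; it remains to take n > 4 /
    |z - 1|. *)
Lemma cesaro_small (z : CC) : `|z| <= 1 -> z != 1 ->
  exists n : nat, `|n.+1%:R^-1 * \sum_(k < n.+1) z ^+ k| < 2%:R^-1.
Proof.
move=> z1 zn; have D0 : 0 < `|z - 1| by rewrite normr_gt0 subr_eq0.
have [|n Hn] := @archimedeanC (4%:R / `|z - 1|); first by rewrite divr_ge0 // ltW.
exists n; have n0 : 0 < n.+1%:R :> CC by rewrite ltr0n.
rewrite normrM normfV (ger0_norm (ltW n0)) mulrC ltr_pdivrMr //.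
rewrite -(ltr_pM2l D0) -normrM -subrX1.
have H : `|z ^+ n.+1 - 1| <= 2%:R.
  apply: le_trans (ler_normB _ _) _; rewrite normr1 -[2%:R]/(1 + 1) lerD2r normrX.
  by rewrite exprn_ile1.
apply: le_lt_trans H _.
have : 4%:R / `|z - 1| < n.+1%:R by apply: lt_le_trans Hn _; rewrite ler_nat.
rewrite ltr_pdivrMr // => H4.
rewrite mulrCA ltr_pdivlMl // -natrM mulrC; exact: H4.
Qed.

Lemma mult_pull (X Y : Type) (d : nat) (b : X -> 'I_d -> CC) (f : Y -> X) phi M :
  mult b phi M -> mult (fun y => b (f y)) (fun y => phi (f y)) M.
Proof. by move=> [M0 H]; split=> //; exact: (PSD_pull f H). Qed.

Section Homomorphism.
Variables (X1 X2 : Type) (d1 d2 : nat) (b1 : X1 -> 'I_d1 -> CC) (b2 : X2 -> 'I_d2 -> CC).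
Hypothesis ball1 : forall x, dot (b1 x) (b1 x) < 1.
Hypothesis ball2 : forall x, dot (b2 x) (b2 x) < 1.
Variable T : (X1 -> CC) -> (X2 -> CC).
Hypothesis T_lin : forall (a : CC) p q, ismult b1 p -> ismult b1 q ->
  T (fun x => a * p x + q x) = (fun y => a * T p y + T q y).
Hypothesis T_mul : forall p q, ismult b1 p -> ismult b1 q ->
  T (fun x => p x * q x) = (fun y => T p y * T q y).
Hypothesis T_one : T (fun _ => 1) = (fun _ => 1).
Hypothesis T_mult : forall p, ismult b1 p -> ismult b2 (T p).

Lemma ismult_cst (a : CC) : ismult b1 (fun _ => a).
Proof. by exists `|a|; exact: mult_cst. Qed.

Lemma ismultM p q : ismult b1 p -> ismult b1 q -> ismult b1 (fun x => p x * q x).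
Proof. by move=> [M HM] [N HN]; exists (M * N); exact: multM. Qed.

Lemma ismult_coord a : ismult b1 (fun x => b1 x a).
Proof. by exists 1; exact: mult_coord. Qed.

Lemma hom_cst (a : CC) : T (fun _ => a) = (fun _ => a).
Proof.
have := linear_scale ball1 T_lin a (ismult_cst 1); rewrite T_one.
rewrite (_ : (fun _ : X1 => a * 1) = fun _ => a); last by apply: funext => x; rewrite mulr1.
by move=> ->; apply: funext => y; rewrite mulr1.
Qed.

Lemma hom_sum (J : finType) (p : J -> X1 -> CC) : (forall j, ismult b1 (p j)) ->
  ismult b1 (fun x => \sum_j p j x) /\
  T (fun x => \sum_j p j x) = (fun y => \sum_j T (p j) y).
Proof.
move=> Hp; elim: (index_enum J) => [|j s [IH1 IH2]].
  have -> : (fun x : X1 => \sum_(j <- [::]) p j x) = (fun _ => 0).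
    by apply: funext => x; rewrite big_nil.
  split; first exact: ismult_cst.
  by rewrite hom_cst; apply: funext => x; rewrite big_nil.
have -> : (fun x : X1 => \sum_(j <- j :: s) p j x) = (fun x => 1 * p j x + \sum_(j <- s) p j x).
  by apply: funext => x; rewrite big_cons mul1r.
split; first exact: ismult_lin.
by rewrite T_lin // IH2; apply: funext => y; rewrite big_cons mul1r.
Qed.

(** If z = T p y exceeded M in modulus, z - p would be invertible among the multipliers, while its
    image vanishes at y. *)
Lemma hom_contr p (M : CC) y : 0 < M -> mult b1 p M -> `|T p y| <= M.
Proof.
move=> M0 Hp; set z := T p y.
rewrite real_leNgt ?normr_real ?gtr0_real //; apply/negP => Mz.
have [nz Hr] := mult_resolvent ball1 M0 Mz Hp.
have ip : ismult b1 p by exists M.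
have ir : ismult b1 (fun x => (z - p x)^-1) by exists (`|z| - M)^-1.
have iz : ismult b1 (fun x => -1 * p x + z) by apply: ismult_lin => //; exact: ismult_cst.
have := T_mul iz ir; rewrite (T_lin _ ip (ismult_cst z)) hom_cst.
have -> : (fun x => (-1 * p x + z) * (z - p x)^-1) = (fun _ => 1).
  by apply: funext => x; rewrite mulN1r addrC mulfV.
rewrite T_one => /(congr1 (fun f => f y)) /eqP /=.
by rewrite -/z mulN1r addNr mul0r oner_eq0.
Qed.

Lemma hom_dot (a : 'I_d1 -> CC) : ismult b1 (fun x => dot (b1 x) a) /\
  T (fun x => dot (b1 x) a) = fun y => dot (fun i => T (fun x => b1 x i) y) a.
Proof.
have H i : ismult b1 (fun x => b1 x i * (a i)^*).
  by apply: ismultM (ismult_coord i) (ismult_cst _).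
have [H1 H2] := hom_sum H; split; first exact: H1.
rewrite /dot H2; apply: funext => y; apply: eq_bigr => i _.
by rewrite T_mul ?hom_cst //; [exact: ismult_coord|exact: ismult_cst].
Qed.

(** Applied to <b, a>, of norm |a|, the character at y takes the value |a|^2, so |a|^2 <= |a|. *)
Lemma hom_point_closed y : dot (fun i => T (fun x => b1 x i) y) (fun i => T (fun x => b1 x i) y) <= 1.
Proof.
set a := fun i => _; pose s := sqrtC (dot a a).
have s0 : 0 <= s by rewrite sqrtC_ge0 dot_ge0.
have sE : s ^+ 2 = dot a a by rewrite sqrtCK.
have [s00|sn] := eqVneq s 0; first by rewrite -sE s00 expr0n ler01.
have sp : 0 < s by rewrite lt_neqAle eq_sym sn s0.
have := hom_contr y sp (mult_dot ball1 s0 sE); rewrite (hom_dot a).2 -/a -sE.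
rewrite ger0_norm ?exprn_ge0 // expr2 -{3}[s]mulr1 ler_pM2l // => s1.
by rewrite mulr_ile1.
Qed.

Hypothesis T_inj : forall p q, ismult b1 p -> ismult b1 q -> T p = T q -> p = q.
Variable x1 : X1.
Hypothesis conn : forall P : X2 -> Prop,
  (forall x, exists2 e : CC, 0 < e &
     forall y, \sum_a `|b2 y a - b2 x a| < e -> (P y <-> P x)) ->
  forall x y, P x -> P y.

(* Otherwise the Cesaro means of a power-bounded multiplier with a fixed value 1 would
   approximate a nontrivial idempotent on the connected set X2. *)
Lemma hom_point_open y : dot (fun i => T (fun x => b1 x i) y) (fun i => T (fun x => b1 x i) y) < 1.
Proof.
rewrite lt_neqAle hom_point_closed andbT; apply/negP => /eqP.
set a := fun i => _ => a1.
pose u x := dot (b1 x) a; have Hu : mult b1 u 1.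
  by apply: mult_dot => //; rewrite expr1n a1.
have iu : ismult b1 u by exists 1.
pose p := T u; have py : p y = 1 by rewrite /p (hom_dot a).2 -/a a1.
have p1 y' : `|p y'| <= 1 by exact: hom_contr Hu.
have Xn n : ismult b1 (fun x => u x ^+ n) by exists (1 ^+ n); exact: multX.
have TX n : T (fun x => u x ^+ n) = fun y => p y ^+ n.
  elim: n => [|n IH]; first by rewrite (_ : (fun x => u x ^+ 0) = fun _ => 1).
  have := T_mul iu (Xn n); rewrite IH.
  have -> : (fun x => u x * u x ^+ n) = (fun x => u x ^+ n.+1) by apply: funext => x; rewrite exprS.
  by move=> ->; apply: funext => x; rewrite exprS.
have [C C0 HC] := uniform_boundedness ball1 ball2 T_lin T_mult hom_contr.
have Hav n : mult b2 (fun y => n.+1%:R^-1 * \sum_(k < n.+1) p y ^+ k) C.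
  have Hs : mult b1 (fun x => \sum_(k < n.+1) u x ^+ k) n.+1%:R.
    elim: n => [|n IH].
      have := multX ball1 0 Hu; rewrite expr0; apply: mult_ext => x.
      by rewrite big_ord1.
    have := multX ball1 n.+1 Hu; rewrite expr1n => Hn.
    have := multD ball1 _ ltr01 IH Hn; rewrite ltr0n => /(_ isT).
    rewrite -[n.+2%:R]natr1; apply: mult_ext => x.
    by rewrite [RHS]big_ord_recr.
  have Hs' : mult b1 (fun x => n.+1%:R^-1 * \sum_(k < n.+1) u x ^+ k) 1.
    have := multZ ball1 n.+1%:R^-1 Hs; rewrite normfV ger0_norm ?ler0n //.
    by rewrite mulVf // pnatr_eq0.
  have := HC _ _ ltr01 Hs'; rewrite mulr1.
  have iS : ismult b1 (fun x => \sum_(k < n.+1) u x ^+ k) by exists n.+1%:R.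
  rewrite (linear_scale ball1 T_lin _ iS).
  rewrite (hom_sum (fun k : 'I_n.+1 => Xn k)).2.
  apply: mult_ext => x; congr (_ * _); apply: eq_bigr => k _; by rewrite TX.
have av1 n z : z = 1 -> n.+1%:R^-1 * \sum_(k < n.+1) z ^+ k = 1 :> CC.
  move=> ->; under eq_bigr do rewrite expr1n.
  by rewrite sumr_const card_ord mulVf // pnatr_eq0.
have P1 y' : p y' = 1.
  apply: (conn (P := fun y => p y = 1)) py => x.
  have [c c0 Hc] := mult_lip ball2 x.
  have cC : 0 < c * C by rewrite mulr_gt0.
  (* Within this radius all Cesaro means vary by less than 1/2. A mean is 1 where p = 1, and falls
     below 1/2 for some n where p differs from 1. *)
  exists (2%:R * (c * C))^-1; first by rewrite invr_gt0 mulr_gt0.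
  move=> z Hz.
  have close n : `|n.+1%:R^-1 * \sum_(k < n.+1) p z ^+ k - n.+1%:R^-1 * \sum_(k < n.+1) p x ^+ k| < 2%:R^-1.
    apply: le_lt_trans (Hc _ _ C0 (Hav n) z) _.
    by rewrite -ltr_pdivlMl // -invfM mulrC.
  have half (w : CC) : `|w| < 2%:R^-1 -> `|w - 1| < 2%:R^-1 -> False.
    move=> h1 h2; have : `|w - (w - 1)| < 2%:R^-1 + 2%:R^-1.
      by apply: le_lt_trans (ler_normB _ _) _; exact: ltrD.
    rewrite (_ : w - (w - 1) = 1); last by ring.
    by rewrite (_ : 2%:R^-1 + 2%:R^-1 = 1) ?normr1 ?ltxx //; field.
  split=> [pz|px].
    apply/eqP; apply: contrapT => /negP pn.
    have [n Hn] := cesaro_small (p1 x) pn; have := close n; rewrite (av1 _ _ pz) distrC.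
    exact: half.
  apply/eqP; apply: contrapT => /negP pn.
  have [n Hn] := cesaro_small (p1 z) pn; have := close n; rewrite (av1 _ _ px).
  exact: half.
(* Injectivity pulls the constant back, but |u| < 1 at [x1], an interior point paired with a unit
   vector. *)
have : u = fun _ => 1.
  apply: T_inj => //; first exact: ismult_cst.
  by rewrite T_one; apply: funext => y'; exact: P1.
move=> /(congr1 (fun f => f x1)) E; have := @norm_dot_lt1 _ _ a (ball1 x1).
by rewrite a1 lexx -/(u x1) E normr1 ltxx => /(_ isT).
Qed.

(** The form in which the variety property is used; [None] is the point l added to the variety. *)
Hypothesis inter : forall l : 'I_d1 -> CC, dot l l < 1 -> (forall x, b1 x <> l) ->
  exists phi : option X1 -> CC,
    [/\ ismult (fun o => if o is Some x then b1 x else l) phi,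
        forall x, phi (Some x) = 0 & phi None != 0].

(** Apply T to the decomposition and evaluate at y: every factor T(b_a)(y) - l_a is 0. The centre l
    need not be a value of [b1]. *)
Lemma hom_vanish y (l : 'I_d1 -> CC) (psi : X1 -> 'I_d1 -> CC) (phi : X1 -> CC) (c : CC) :
  (forall i, T (fun x => b1 x i) y = l i) -> (forall a, ismult b1 (psi^~ a)) ->
  ismult b1 phi ->
  (forall x, phi x - c = \sum_a (b1 x a - l a) * psi x a) -> T phi y = c.
Proof.
move=> Hl Hpsi iphi E.
have Hb a : ismult b1 (fun x => 1 * b1 x a + - l a).
  by apply: ismult_lin (ismult_coord a) (ismult_cst _).
have Hs a : ismult b1 (fun x => (1 * b1 x a + - l a) * psi x a) by exact: ismultM.
have E' : (fun x => 1 * phi x + - c) = fun x => \sum_a (1 * b1 x a + - l a) * psi x a.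
  by apply: funext => x; rewrite mul1r E; apply: eq_bigr => a _; rewrite mul1r.
have := congr1 (fun f => T f y) E'; rewrite (hom_sum Hs).2 T_lin //; last exact: ismult_cst.
rewrite hom_cst mul1r big1 => [/eqP|a _]; first by rewrite subr_eq0 => /eqP.
rewrite T_mul // T_lin; [|exact: ismult_coord|exact: ismult_cst].
by rewrite hom_cst mul1r Hl subrr mul0r.
Qed.

Lemma hom_composition : exists nu : X2 -> X1, forall p, ismult b1 p -> T p = fun y => p (nu y).
Proof.
suff H y : exists x, forall p, ismult b1 p -> T p y = p x.
  have [nu Hnu] := boolp.choice H; exists nu => p Hp; apply: funext => y; exact: Hnu.
pose l i := T (fun x => b1 x i) y.
have l1 : dot l l < 1 by exact: hom_point_open.
have [x0 Hx0] : exists x, b1 x = l.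
  apply: contrapT => nx.
  have [|phi [iphi phi0 phin]] := inter l1; first by move=> x bx; apply: nx; exists x.
  have ballo (o : option X1) : dot (if o is Some x then b1 x else l) (if o is Some x then b1 x else l) < 1.
    by case: o.
  have [M M0 HM] := ismult_pos ballo iphi.
  (* Centred at the added point and then restricted to X1, where phi vanishes, the decomposition
     forces T 0 to take the nonzero value phi(None). *)
  have [c _ Hc] := gleason ballo None.
  have [psi [E Hpsi]] := Hc _ _ M0 HM.
  have : T (fun _ => 0) y = phi None.
    apply: (@hom_vanish y l (fun x => psi (Some x))) => //.
    - by move=> a; exists (c * M); exact: (mult_pull Some (Hpsi a)).
    - exact: ismult_cst.
    - by move=> x; have := E (Some x); rewrite phi0.
  by rewrite hom_cst => /esym /eqP; rewrite (negPf phin).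
exists x0 => p Hp.
have [M M0 HM] := ismult_pos ball1 Hp.
have [c _ Hc] := gleason ball1 x0.
have [psi [E Hpsi]] := Hc _ _ M0 HM.
apply: (@hom_vanish y (b1 x0) psi) => //.
- by move=> i; rewrite Hx0.
- by move=> a; exists (c * M).
Qed.

End Homomorphism.

(** * Translation of the definitions *)

(** Both models are pairs of the same reals, so the ring operations agree by computation; only
    inversion needs an argument. *)
Definition toCC (z : Complex.C) : CC := Complex z.1 z.2.
Definition ofCC (z : CC) : Complex.C := (complex.Re z, complex.Im z).

Lemma toCCK z : ofCC (toCC z) = z. Proof. by case: z. Qed.
Lemma ofCCK z : toCC (ofCC z) = z. Proof. by case: z. Qed.
Lemma toCC_inj : injective toCC. Proof. exact: can_inj toCCK. Qed.
Lemma toCCD z w : toCC (Cplus z w) = toCC z + toCC w. Proof. by []. Qed.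
Lemma toCCB z w : toCC (Cminus z w) = toCC z - toCC w. Proof. by []. Qed.
Lemma toCCM z w : toCC (Cmult z w) = toCC z * toCC w. Proof. by []. Qed.
Lemma toCCJ z : toCC (Cconj z) = (toCC z)^*. Proof. by []. Qed.
Lemma toCCR (r : R) : toCC (RtoC r) = r%:C%C. Proof. by []. Qed.
Lemma toCC_0 : toCC (RtoC 0) = 0. Proof. by []. Qed.
Lemma toCC_1 : toCC (RtoC 1) = 1. Proof. by []. Qed.

Lemma toCC_eq0 z : toCC z = 0 -> z = RtoC 0.
Proof. by move=> H; apply: toCC_inj. Qed.

Lemma toCCV z : toCC z != 0 -> toCC (Cinv z) = (toCC z)^-1.
Proof.
move=> z0; apply: (mulIf z0); rewrite mulVf // -toCCM Cinv_l //.
by move=> E; rewrite E toCC_0 eqxx in z0.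
Qed.

Lemma toCC_norm z : `|toCC z| = (Cmod z)%:C%C.
Proof. by rewrite normc_def /Cmod RsqrtE !RpowE. Qed.

Lemma toCC_ge0 z : 0 <= toCC z <-> snd z = IZR 0 /\ Rle (IZR 0) (fst z).
Proof.
rewrite lecE /=; split=> [/andP[/eqP h1 h2]|[h1 h2]]; first by split=> //; apply/RleP.
by rewrite h1 eqxx; apply/RleP.
Qed.

Lemma toCC_csum n F : toCC (csum n F) = \sum_(i < n) toCC (F i).
Proof.
elim: n => [|n IH] /=; first by rewrite big_ord0.
by rewrite toCCD IH big_ord_recr.
Qed.

Lemma idx_proof (d : nat) (i : 'I_d) : Nat.ltb i d = true.
Proof. by apply/Nat.ltb_spec0; apply/ssrnat.ltP. Qed.

Definition idx (d : nat) (i : 'I_d) : Idx d := exist _ (i : nat) (idx_proof i).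

Lemma idx_surj d (j : Idx d) : exists i, idx i = j.
Proof.
case: j => j Hj; have jd : (j < d)%N by apply/ssrnat.ltP/Nat.ltb_spec0.
exists (Ordinal jd); rewrite /idx; congr exist; exact: Prop_irrelevance.
Qed.

Definition vec (d : nat) (v : Cvec d) : 'I_d -> CC := fun i => toCC (v (idx i)).

Lemma vec_inj d (v w : Cvec d) : vec v = vec w -> v = w.
Proof.
move=> E; apply: funext => j; have [i <-] := idx_surj j.
by apply: toCC_inj; have := congr1 (fun f => f i) E.
Qed.

Lemma vec_surj d (l : 'I_d -> CC) : exists v : Cvec d, vec v = l.
Proof.
have [r Hr] := boolp.choice (@idx_surj d).
exists (fun j => ofCC (l (r j))); apply: funext => i; rewrite /vec ofCCK.
congr l; apply: val_inj => /=; have := Hr (idx i) => E.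
by have := congr1 (fun j : Idx d => proj1_sig j) E.
Qed.

Lemma toCC_isum d (a : Idx d -> Complex.C) : toCC (isum d a) = \sum_(i < d) toCC (a (idx i)).
Proof.
rewrite /isum toCC_csum; apply: eq_bigr => i _; congr toCC.
have := idx_proof i; rewrite /idx.
have G b (E : Nat.ltb i d = b) (H : Nat.ltb i d = true) :
  (match b as b0 return Nat.ltb i d = b0 -> Complex.C with
    | true => fun H => a (exist _ (i : nat) H) | false => fun _ => RtoC 0 end) E = a (exist _ (i : nat) H).
  by case: b E => E; [congr (a (exist _ _ _)); exact: Prop_irrelevance|have := E; rewrite H].
by move=> H; rewrite (G _ erefl (idx_proof i)).
Qed.

Lemma toCC_cinner d (v w : Cvec d) : toCC (cinner d v w) = dot (vec v) (vec w).
Proof. by rewrite toCC_isum. Qed.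

Lemma vnormE d (v : Cvec d) : dot (vec v) (vec v) = (Rmult (vnorm d v) (vnorm d v))%:C%C.
Proof.
have := dot_ge0 (vec v); rewrite -toCC_cinner => /toCC_ge0 [h1 h2].
rewrite /vnorm sqrt_sqrt //; apply/eqP; rewrite eq_complex /= h1 !eqxx.
by [].
Qed.

Lemma vnorm_ge0 d (v : Cvec d) : Rle (IZR 0) (vnorm d v).
Proof. exact: sqrt_pos. Qed.

Lemma Ball_vec d (v : Cvec d) : Ball d v <-> dot (vec v) (vec v) < 1.
Proof.
have /RleP v0 := vnorm_ge0 v; rewrite vnormE RmultE -expr2.
rewrite (_ : (_ < 1) = (vnorm d v ^+ 2 < 1)); last by rewrite -ltcR.
by rewrite expr_lt1 //; split=> /RltP.
Qed.

Section Bridge.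
Variables (X : Type) (S : X -> Prop).
Implicit Types K : X -> X -> Complex.C.

Lemma PosKernelE K : PosKernel S K <->
  PSD (fun x y : {x | S x} => toCC (K (proj1_sig x) (proj1_sig y))).
Proof.
split=> [H I x c|H n x c Sx].
  (* An index serves as the default point for sequences over the integers, so the empty family is
     treated apart. *)
  have [[i0]|nI] := pselect (inhabited I); last first.
    by rewrite big1 // => i _; case: nI.
  pose x' (n : nat) := if insub n is Some k then proj1_sig (x (enum_val (k : 'I_#|I|))) else proj1_sig (x i0).
  pose c' (n : nat) := if insub n is Some k then ofCC (c (enum_val (k : 'I_#|I|))) else RtoC 0.
  have Sx i : (i < #|I|)%coq_nat -> S (x' i).
    by move=> _; rewrite /x'; case: insubP => [k _ _|_]; exact: proj2_sig.
  have H' : 0 <= \sum_(k < #|I|) \sum_(l < #|I|) (c (enum_val k))^* * c (enum_val l) *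
     toCC (K (proj1_sig (x (enum_val k))) (proj1_sig (x (enum_val l)))).
    have /toCC_ge0 := H #|I| x' c' Sx; rewrite toCC_csum.
    congr (0 <= _); apply: eq_bigr => k _; rewrite toCC_csum; apply: eq_bigr => l _.
    by rewrite !toCCM toCCJ /c' /x' !valK !ofCCK.
  move: H'; congr (0 <= _).
  rewrite -(@big_enum_val _ _ _ I predT (fun i => \sum_(l < #|I|) (c i)^* * c (enum_val l) *
     toCC (K (proj1_sig (x i)) (proj1_sig (x (enum_val l)))))).
  apply: eq_bigr => i _.
  by rewrite -(@big_enum_val _ _ _ I predT (fun j => (c i)^* * c j *
     toCC (K (proj1_sig (x i)) (proj1_sig (x j))))).
apply/toCC_ge0; rewrite toCC_csum.
have := H 'I_n (fun i => exist _ (x i) (Sx i (ssrnat.ltP (ltn_ord i)))) (fun i => toCC (c i)).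
congr (0 <= _); apply: eq_bigr => i _; rewrite toCC_csum; apply: eq_bigr => j _.
by rewrite !toCCM toCCJ.
Qed.

Variables (d : nat) (K : X -> X -> Complex.C) (b : {x | S x} -> 'I_d -> CC).
Hypothesis ball : forall x, dot (b x) (b x) < 1.
Hypothesis HK : forall x y, toCC (K (proj1_sig x) (proj1_sig y)) = ker b x y.

Lemma HNormLeE h (r : R) : HNormLe S K h r <-> 0 <= r /\
  PSD (fun x y => r%:C%C ^+ 2 * ker b x y - toCC (h (proj1_sig x)) * (toCC (h (proj1_sig y)))^*).
Proof.
have E x y : toCC (Cminus (Cmult (RtoC (Rmult r r)) (K (proj1_sig x) (proj1_sig y)))
    (Cmult (h (proj1_sig x)) (Cconj (h (proj1_sig y))))) =
  r%:C%C ^+ 2 * ker b x y - toCC (h (proj1_sig x)) * (toCC (h (proj1_sig y)))^*.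
  by rewrite toCCB !toCCM toCCJ toCCR HK -rmorphXn.
split=> -[/RleP r0 H]; split=> //.
  move/PosKernelE: H; exact: PSD_ext.
by apply/PosKernelE; apply: PSD_ext H.
Qed.

(* Cauchy-Schwarz for the semi-inner product defined by the kernel. *)
Lemma kernel_combination_norm (I : finType) (x : I -> {x | S x}) (a : I -> CC)
  (g := fun y => \sum_j a j * ker b y (x j))
  (B := \sum_i \sum_j (a i)^* * a j * ker b (x i) (x j)) :
  0 < B -> PSD (fun y z => B * ker b y z - g y * (g z)^*).
Proof.
move=> B0 J y e; have Bn : B != 0 by rewrite gt_eqF.
have Br : B^* = B by rewrite geC0_conj // ltW.
pose G := \sum_k (e k)^* * g (y k).
pose E := \sum_k \sum_l (e k)^* * e l * ker b (y k) (y l).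
have GC : G^* = \sum_k \sum_j e k * (a j)^* * ker b (x j) (y k).
  rewrite /G rmorph_sum; apply: eq_bigr => k _; rewrite rmorphM /= conjCK /g rmorph_sum mulr_sumr.
  by apply: eq_bigr => j _; rewrite rmorphM /= kerC mulrA.
have H : 0 <= E - G * G^* / B.
  have := psd1 ball (fun p : J + I => match p with inl k => y k | inr i => x i end)
    (fun p => match p with inl k => e k | inr i => - G^* / B * a i end).
  congr (0 <= _); rewrite big_sumType /=.
  under eq_bigr do rewrite big_sumType /=.
  under [X in _ + X = _]eq_bigr do rewrite big_sumType /=.
  rewrite !big_split /=.
  have -> : \sum_i \sum_j (e i)^* * e j * (1 * ker b (y i) (y j)) = E.
    by apply: eq_bigr => i _; apply: eq_bigr => j _; rewrite mul1r.
  have -> : \sum_i \sum_j (e i)^* * (- G^* / B * a j) * (1 * ker b (y i) (x j)) = - G^* / B * G.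
    rewrite mulr_sumr; apply: eq_bigr => i _; rewrite mulr_sumr mulr_sumr.
    by apply: eq_bigr => j _; ring.
  have -> : \sum_i \sum_j (- G^* / B * a i)^* * e j * (1 * ker b (x i) (y j)) = - G / B * G^*.
    rewrite [in RHS]GC exchange_big /= mulr_sumr; apply: eq_bigr => j _.
    rewrite mulr_sumr; apply: eq_bigr => i _.
    by rewrite !rmorphM fmorphV rmorphN /= conjCK Br; ring.
  have -> : \sum_i \sum_j (- G^* / B * a i)^* * (- G^* / B * a j) * (1 * ker b (x i) (x j))
     = G * G^* / B.
    transitivity (G * G^* / B ^+ 2 * \sum_i \sum_j (a i)^* * a j * ker b (x i) (x j));
      last by rewrite -/B; field.
    rewrite mulr_sumr; apply: eq_bigr => i _; rewrite mulr_sumr.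
    apply: eq_bigr => j _; rewrite !rmorphM fmorphV rmorphN /= conjCK Br; by field.
  by field.
have := mulr_ge0 (ltW B0) H; congr (0 <= _).
have -> : B * (E - G * G^* / B) = B * E - G * G^* by field.
have GC' : G^* = \sum_k e k * (g (y k))^*.
  by rewrite /G rmorph_sum; apply: eq_bigr => k _; rewrite rmorphM /= conjCK.
clear GC; clearbody g B.
have -> : B * E = \sum_k \sum_m B * ((e k)^* * e m * ker b (y k) (y m)).
  by rewrite mulr_sumr; apply: eq_bigr => k _; rewrite mulr_sumr.
have -> : G * G^* = \sum_k \sum_m ((e k)^* * g (y k)) * (e m * (g (y m))^*).
  by rewrite GC' mulr_suml; apply: eq_bigr => k _; rewrite mulr_sumr.
rewrite -sumrB; apply: eq_bigr => k _; rewrite -sumrB; apply: eq_bigr => m _; ring.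
Qed.

Lemma MultNormLeE phi (M : R) : MultNormLe S K phi M <->
  mult b (fun x => toCC (phi (proj1_sig x))) (M%:C%C).
Proof.
split=> [[/RleP M0 H]|[M0 H]]; last first.
  have M0' : 0 <= M by rewrite -ler0c.
  split=> [|h r /HNormLeE [r0 Hh]]; first by apply/RleP.
  apply/HNormLeE; split; first exact: mulr_ge0.
  have r0' : 0 <= r%:C%C :> CC by rewrite ler0c.
  apply: PSD_ext (PSD_add (PSD_scale (exprn_ge0 2 r0') H)
    (PSD_congr (fun x => toCC (phi (proj1_sig x))) Hh)) => x y.
  by rewrite !toCCM !rmorphM /=; ring.
split=> [|I x c]; first by rewrite ler0c.
(* These are the coefficients of M_phi^* f, and B is its squared norm. Testing phi h with c gives B
   (M^2 Q - B) >= 0, from which B > 0 cancels. *)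
pose a i := c i * (toCC (phi (proj1_sig (x i))))^*.
pose B := \sum_i \sum_j (a i)^* * a j * ker b (x i) (x j).
pose Q := \sum_i \sum_j (c i)^* * c j * ker b (x i) (x j).
have Q0 : 0 <= Q.
  have := psd1 ball x c; congr (0 <= _); apply: eq_bigr => i _; apply: eq_bigr => j _.
  by rewrite mul1r.
have -> : \sum_k \sum_l (c k)^* * c l * ((M%:C%C ^+ 2 - toCC (phi (proj1_sig (x k))) *
   (toCC (phi (proj1_sig (x l))))^*) * ker b (x k) (x l)) = M%:C%C ^+ 2 * Q - B.
  rewrite /Q /B mulr_sumr -sumrB; apply: eq_bigr => i _.
  rewrite mulr_sumr -sumrB; apply: eq_bigr => j _; rewrite /a rmorphM /= conjCK; ring.
have M0' : 0 <= M%:C%C ^+ 2 :> CC by rewrite exprn_ge0 // ler0c.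
have B0 : 0 <= B.
  have := psd1 ball x a; congr (0 <= _); apply: eq_bigr => i _; apply: eq_bigr => j _.
  by rewrite mul1r.
have [->|Bn] := eqVneq B 0; first by rewrite subr0 mulr_ge0.
have Bp : 0 < B by rewrite lt_neqAle eq_sym Bn.
have HP := kernel_combination_norm Bp.
pose h (z : X) : Complex.C := ofCC (\sum_j a j * toCC (K z (proj1_sig (x j)))).
have hE y : toCC (h (proj1_sig y)) = \sum_j a j * ker b y (x j).
  by rewrite ofCCK; apply: eq_bigr => j _; rewrite HK.
have [r Er] : exists r, sqrtC B = r%:C%C.
  by apply/complex_realP; rewrite ger0_real // sqrtC_ge0.
have r0 : 0 <= r by rewrite -ler0c -Er sqrtC_ge0.
have rB : r%:C%C ^+ 2 = B by rewrite -Er sqrtCK.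
have Hh : HNormLe S K h r.
  apply/HNormLeE; split=> //; apply: PSD_ext HP => y z.
  by rewrite rB !hE.
have /HNormLeE [_ H2] := H _ _ Hh; have := H2 I x c.
have -> : \sum_k \sum_l (c k)^* * c l * ((Rmult M r)%:C%C ^+ 2 * ker b (x k) (x l) -
  toCC (Cmult (phi (proj1_sig (x k))) (h (proj1_sig (x k)))) *
  (toCC (Cmult (phi (proj1_sig (x l))) (h (proj1_sig (x l)))))^*) = B * (M%:C%C ^+ 2 * Q - B).
  have BE : B = \sum_k (c k)^* * toCC (Cmult (phi (proj1_sig (x k))) (h (proj1_sig (x k)))).
    rewrite /B; apply: eq_bigr => k _; rewrite toCCM hE !mulr_sumr; apply: eq_bigr => l _.
    by rewrite /a rmorphM /= conjCK; ring.
  have Br : B^* = B by rewrite geC0_conj.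
  have -> : B * (M%:C%C ^+ 2 * Q - B) = (Rmult M r)%:C%C ^+ 2 * Q - B * B^*.
    by rewrite Br -{1}rB RmultE rmorphM /=; rewrite rB exprMn rB; ring.
  have BC : B^* = \sum_k c k * (toCC (Cmult (phi (proj1_sig (x k))) (h (proj1_sig (x k)))))^*.
    by rewrite BE rmorph_sum; apply: eq_bigr => k _; rewrite rmorphM /= conjCK.
  pose q k := toCC (Cmult (phi (proj1_sig (x k))) (h (proj1_sig (x k)))).
  have -> : B * B^* = \sum_k \sum_m ((c k)^* * q k) * (c m * (q m)^*).
    by rewrite BC {1}BE mulr_suml; apply: eq_bigr => k _; rewrite mulr_sumr.
  have -> : (Rmult M r)%:C%C ^+ 2 * Q =
     \sum_k \sum_m (Rmult M r)%:C%C ^+ 2 * ((c k)^* * c m * ker b (x k) (x m)).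
    by rewrite mulr_sumr; apply: eq_bigr => k _; rewrite mulr_sumr.
  rewrite -sumrB; apply: eq_bigr => k _; rewrite -sumrB; apply: eq_bigr => m _.
  rewrite -/(q k) -/(q m); ring.
by rewrite pmulr_rge0.
Qed.

Lemma IsMultE phi : IsMult S K phi <-> ismult b (fun x => toCC (phi (proj1_sig x))).
Proof.
split=> [[M /MultNormLeE H]|[M H]]; first by exists M%:C%C.
have [m Em] : exists m, M = m%:C%C.
  by apply/complex_realP; rewrite ger0_real //; case: H.
by exists m; apply/MultNormLeE; rewrite -Em.
Qed.

End Bridge.

(** * Multiplier algebras of embedding maps *)

(** On the subtype, [eqD] becomes plain equality of functions. *)
Definition disc := {z : Complex.C | Disc z}.

Definition emb (d : nat) (f : Complex.C -> Cvec d) : disc -> 'I_d -> CC :=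
  fun x => vec (f (proj1_sig x)).

Definition restr (phi : Complex.C -> Complex.C) : disc -> CC :=
  fun x => toCC (phi (proj1_sig x)).

Definition ext (p : disc -> CC) : Complex.C -> Complex.C :=
  fun z => if pselect (Disc z) is left H then ofCC (p (exist _ z H)) else RtoC 0.

Lemma extE p (x : disc) : ext p (proj1_sig x) = ofCC (p x).
Proof.
case: x => z H; rewrite /ext /=; case: pselect => // H'.
by rewrite (Prop_irrelevance H' H).
Qed.

Lemma restr_ext p : restr (ext p) = p.
Proof. by apply: funext => x; rewrite /restr extE ofCCK. Qed.

Lemma eqD_restr phi psi : eqD phi psi <-> restr phi = restr psi.
Proof.
split=> [E|E z Dz]; first by apply: funext => -[z Dz]; rewrite /restr /= E.
by apply: toCC_inj; exact: (congr1 (fun h => h (exist _ z Dz : disc)) E).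
Qed.

Lemma emb_ball d (f : Complex.C -> Cvec d) : (forall x, Disc x -> Ball d (f x)) ->
  forall x, dot (emb f x) (emb f x) < 1.
Proof. by move=> H [z Dz]; apply/Ball_vec/H. Qed.

Lemma toCC_kernel d (v w : Cvec d) : Ball d v -> Ball d w ->
  toCC (Cinv (Cminus (RtoC 1) (cinner d v w))) = (1 - dot (vec v) (vec w))^-1.
Proof.
move=> /Ball_vec Hv /Ball_vec Hw.
have n0 := @ker_den bool d (fun b => if b then vec v else vec w).
rewrite toCCV toCCB toCC_1 toCC_cinner //.
by apply: (n0 _ true false) => -[].
Qed.

Section Embedding.
Variables (d : nat) (f : Complex.C -> Cvec d).
Hypothesis Hf : EmbeddingMap d f.

Lemma embedding_ball x : Disc x -> Ball d (f x).
Proof. by case: Hf => _ [H _]; exact: H. Qed.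

Lemma embedding_dot x : dot (emb f x) (emb f x) < 1.
Proof. exact: emb_ball embedding_ball x. Qed.

Lemma embedding_mult phi (M : R) :
  MultNormLe Disc (kerOf d f) phi M <-> mult (emb f) (restr phi) (M%:C%C).
Proof.
apply: MultNormLeE; first exact: embedding_dot.
by move=> [x Dx] [y Dy]; apply: toCC_kernel; exact: embedding_ball.
Qed.

Lemma embedding_ismult phi : IsMult Disc (kerOf d f) phi <-> ismult (emb f) (restr phi).
Proof.
apply: IsMultE; first exact: embedding_dot.
by move=> [x Dx] [y Dy]; apply: toCC_kernel; exact: embedding_ball.
Qed.

Lemma embedding_inj x y : emb f x = emb f y -> x = y.
Proof.
case: x y => [x Dx] [y Dy] /vec_inj /= E; case: Hf => _ [_ [inj _]].
have xy := inj x y Dx Dy E; move: Dx Dy {E}; rewrite xy => Dx Dy.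
by rewrite (Prop_irrelevance Dx Dy).
Qed.

(** Some multiplier of the family cutting out the variety is nonzero at l; it is restricted from the
    ball to the variety and l. *)
Lemma embedding_separation (l : 'I_d -> CC) : dot l l < 1 -> (forall x, emb f x <> l) ->
  exists phi : option disc -> CC,
    [/\ ismult (fun o => if o is Some x then emb f x else l) phi,
        forall x, phi (Some x) = 0 & phi None != 0].
Proof.
have [v <-] := vec_surj l => /Ball_vec Bv Hv.
have [[_ [F [HF1 HF2]]] _] := Hf.
have nV : ~ imgDisc d f v.
  by move=> [x [Dx E]]; apply: (Hv (exist _ x Dx)); rewrite /emb /= E.
have [phi Fphi phiv] : exists2 phi, F phi & phi v <> RtoC 0.
  apply: contrapT => K; apply: nV; apply/HF2 => // phi Fphi.
  by apply: contrapT => K'; apply: K; exists phi.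
pose pt (o : option disc) : Cvec d := if o is Some x then f (proj1_sig x) else v.
have Bpt o : Ball d (pt o) by case: o => [[x Dx]|] //; exact: embedding_ball.
have Hm : ismult (fun x : {x | Ball d x} => vec (proj1_sig x)) (fun x => toCC (phi (proj1_sig x))).
  have := HF1 _ Fphi; apply (@IsMultE _ (Ball d) d (DAker d)).
    by move=> [x Bx] /=; apply/Ball_vec.
  by move=> [x Bx] [y By]; exact: toCC_kernel.
exists (fun o => toCC (phi (pt o))); split.
- have [M HM] := Hm; exists M.
  have := mult_pull (fun o => exist _ (pt o) (Bpt o) : {x | Ball d x}) HM.
  rewrite (_ : (fun y => vec _) = (fun o => if o is Some x then emb f x else vec v)) //.
  by apply: funext => -[].
- move=> [x Dx] /=; have -> : phi (f x) = RtoC 0; last exact: toCC_0.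
  by apply: (proj1 (HF2 _ (embedding_ball Dx))) => //; exists x.
- by apply/eqP => /toCC_eq0.
Qed.

End Embedding.

Definition alg_hom (X1 X2 : Type) (d1 d2 : nat) (b1 : X1 -> 'I_d1 -> CC)
  (b2 : X2 -> 'I_d2 -> CC) (T : (X1 -> CC) -> (X2 -> CC)) : Prop :=
  [/\ forall p, ismult b1 p -> ismult b2 (T p),
      forall (a : CC) p q, ismult b1 p -> ismult b1 q ->
        T (fun x => a * p x + q x) = (fun y => a * T p y + T q y),
      forall p q, ismult b1 p -> ismult b1 q ->
        T (fun x => p x * q x) = (fun y => T p y * T q y) &
      T (fun _ => 1) = (fun _ => 1)].

(** [MultAlgIso] mentions neither the unit nor an inverse. The inverse is chosen by surjectivity,
    and its algebraic laws follow from injectivity of T. *)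
Lemma MultAlgIso_alg_hom (d : nat) (f g : Complex.C -> Cvec d) :
  EmbeddingMap d f -> EmbeddingMap d g -> MultAlgIso (kerOf d f) (kerOf d g) ->
  exists T T', [/\ alg_hom (emb f) (emb g) T, alg_hom (emb g) (emb f) T',
    forall p, ismult (emb f) p -> T' (T p) = p &
    forall r, ismult (emb g) r -> T (T' r) = r].
Proof.
move=> Hf Hg [Phi [P1 [P2 [P3 [P4 [P5 P6]]]]]].
have bf := embedding_dot Hf; have bg := embedding_dot Hg.
have ie p : ismult (emb f) p -> IsMult Disc (kerOf d f) (ext p).
  by move=> H; apply/(embedding_ismult Hf); rewrite restr_ext.
pose T p := restr (Phi (ext p)).
have Tm p : ismult (emb f) p -> ismult (emb g) (T p).
  by move=> H; apply/(embedding_ismult Hg)/P1/ie.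
have Text p phi : ismult (emb f) p -> restr phi = p -> T p = restr (Phi phi).
  move=> ip E; apply/eqD_restr; apply: P2; first exact: ie.
    by apply/(embedding_ismult Hf); rewrite E.
  by apply/eqD_restr; rewrite restr_ext.
have Tl (a : CC) p q : ismult (emb f) p -> ismult (emb f) q ->
    T (fun x => a * p x + q x) = (fun y => a * T p y + T q y).
  move=> ip iq; rewrite (Text _ (fun z => Cplus (Cmult (ofCC a) (ext p z)) (ext q z))).
  - have /eqD_restr -> := P3 (ofCC a) _ _ (ie _ ip) (ie _ iq).
    by apply: funext => y; rewrite /restr toCCD toCCM ofCCK.
  - exact: ismult_lin.
  - by apply: funext => y; rewrite /restr toCCD toCCM !extE !ofCCK.
have Tmu p q : ismult (emb f) p -> ismult (emb f) q ->
    T (fun x => p x * q x) = (fun y => T p y * T q y).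
  move=> ip iq; rewrite (Text _ (fun z => Cmult (ext p z) (ext q z))).
  - have /eqD_restr -> := P4 _ _ (ie _ ip) (ie _ iq).
    by apply: funext => y; rewrite /restr toCCM.
  - exact: ismultM.
  - by apply: funext => y; rewrite /restr toCCM !extE !ofCCK.
have Tinj p q : ismult (emb f) p -> ismult (emb f) q -> T p = T q -> p = q.
  move=> ip iq /eqD_restr E; have /eqD_restr := P5 _ _ (ie _ ip) (ie _ iq) E.
  by rewrite !restr_ext.
have Tsur r : ismult (emb g) r -> exists p, ismult (emb f) p /\ T p = r.
  move=> ir; have [|phi [iphi E]] := P6 (ext r).
    by apply/(embedding_ismult Hg); rewrite restr_ext.
  have ip : ismult (emb f) (restr phi) by apply/(embedding_ismult Hf).
  exists (restr phi); split=> //; rewrite (Text _ phi) //.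
  by move/eqD_restr: E; rewrite restr_ext.
have one1 : ismult (emb f) (fun _ => 1) by exact: ismult_cst.
have one2 : ismult (emb g) (fun _ => 1) by exact: ismult_cst.
(* With T p = 1, multiplicativity gives 1 = T(1 p) = T(1) T(p) = T(1). *)
have T1 : T (fun _ => 1) = (fun _ => 1).
  have [p [ip Tp]] := Tsur _ one2; have := Tmu _ _ one1 ip.
  rewrite Tp (_ : (fun x => 1 * p x) = p) ?Tp; last by apply: funext => x; rewrite mul1r.
  move=> E; apply: funext => y; have := congr1 (fun h => h y) E.
  by rewrite mulr1 => <-.
have sur r : exists p, ismult (emb g) r -> ismult (emb f) p /\ T p = r.
  have [/Tsur [p Hp]|n] := pselect (ismult (emb g) r); first by exists p.
  by exists (fun _ => 0).
have [T' HT'] := boolp.choice sur.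
have T'm r (ir : ismult (emb g) r) : ismult (emb f) (T' r) by case: (HT' r ir).
have TT' r (ir : ismult (emb g) r) : T (T' r) = r by case: (HT' r ir).
have lin2 (a : CC) p q : ismult (emb g) p -> ismult (emb g) q ->
  ismult (emb g) (fun x => a * p x + q x) by exact: ismult_lin.
have mul2 p q : ismult (emb g) p -> ismult (emb g) q ->
  ismult (emb g) (fun x => p x * q x) by exact: ismultM.
exists T, T'; split=> //.
- split=> // [a p q ip iq|p q ip iq|].
  + apply: Tinj; [exact/T'm/lin2|by apply: ismult_lin => //; exact: T'm|].
    by rewrite TT' ?Tl ?TT' //; [exact: T'm|exact: T'm|exact: lin2].
  + apply: Tinj; [exact/T'm/mul2|by apply: ismultM; exact: T'm|].
    by rewrite TT' ?Tmu ?TT' //; [exact: T'm|exact: T'm|exact: mul2].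
  + by apply: Tinj => //; [exact: T'm|rewrite TT' // T1].
- by move=> p ip; apply: Tinj => //; [exact/T'm/Tm|rewrite TT' //; exact: Tm].
Qed.

(** * Holomorphy of the induced map *)

Definition point (x : disc) : CC := toCC (proj1_sig x).

Lemma point_inj : injective point.
Proof.
move=> [x Dx] [y Dy] /toCC_inj /= E; move: Dx Dy; rewrite E => Dx Dy.
by rewrite (Prop_irrelevance Dx Dy).
Qed.

Lemma pos_real (e : CC) : 0 < e -> exists2 r : R, Rlt (IZR 0) r & e = r%:C%C.
Proof.
move=> e0; have [r Er] : exists r, e = r%:C%C by apply/complex_realP; exact: gtr0_real.
by exists r => //; apply/RltP; rewrite -ltcR -Er.
Qed.

Lemma common_pos (a b : CC) : 0 < a -> 0 < b -> exists2 c : CC, 0 < c & c <= a /\ c <= b.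
Proof.
move=> a0 b0; have ab : 0 < a + b by rewrite addr_gt0.
exists (a * b / (a + b)); first by rewrite divr_gt0 // mulr_gt0.
split; rewrite ler_pdivrMr //.
  by rewrite ler_pM2l // lerDr ltW.
by rewrite mulrC ler_pM2l // lerDl ltW.
Qed.

Definition cts (h : disc -> CC) (x0 : disc) : Prop :=
  forall e : CC, 0 < e -> exists2 dl : CC, 0 < dl &
    forall x, `|point x - point x0| < dl -> `|h x - h x0| < e.

Lemma cts_cst (a : CC) x0 : cts (fun _ => a) x0.
Proof. by move=> e e0; exists 1 => // x _; rewrite subrr normr0. Qed.

Lemma ctsD h k x0 : cts h x0 -> cts k x0 -> cts (fun x => h x + k x) x0.
Proof.
move=> Hh Hk e e0; have e2 : 0 < e / 2%:R by rewrite divr_gt0.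
have [a a0 Ha] := Hh _ e2; have [b b0 Hb] := Hk _ e2.
have [c c0 [ca cb]] := common_pos a0 b0; exists c => // x xc.
rewrite opprD addrACA (splitr e); apply: le_lt_trans (ler_normD _ _) _.
by apply: ltrD; [apply: Ha|apply: Hb]; apply: lt_le_trans xc _.
Qed.

Lemma ctsM h k x0 : cts h x0 -> cts k x0 -> cts (fun x => h x * k x) x0.
Proof.
move=> Hh Hk e e0; pose A := `|h x0| + `|k x0| + 1.
have A1 : 1 <= A by rewrite lerDr addr_ge0.
have A0 : 0 < A by exact: lt_le_trans A1.
have Ae : 0 < A + e by rewrite addr_gt0.
pose f := e / (A + e); have f0 : 0 < f by rewrite divr_gt0.
have f1 : f <= 1 by rewrite ler_pdivrMr // mul1r lerDr ltW.
have [a a0 Ha] := Hh _ f0; have [b b0 Hb] := Hk _ f0.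
have [c c0 [ca cb]] := common_pos a0 b0; exists c => // x xc.
have h1 : `|h x - h x0| < f by apply: Ha; apply: lt_le_trans xc _.
have k1 : `|k x - k x0| < f by apply: Hb; apply: lt_le_trans xc _.
have -> : h x * k x - h x0 * k x0 = (h x - h x0) * (k x - k x0) +
   (h x0 * (k x - k x0) + k x0 * (h x - h x0)) by ring.
apply: (@le_lt_trans _ _ (f * A)); last first.
  by rewrite /f mulrAC ltr_pdivrMr // ltr_pM2l // ltrDl.
apply: le_trans (ler_normD _ _) _.
apply: le_trans (lerD (lexx _) (ler_normD _ _)) _; rewrite !normrM /A.
have -> : f * (`|h x0| + `|k x0| + 1) = f * 1 + (`|h x0| * f + `|k x0| * f) by ring.
apply: lerD; first by apply: ler_pM => //; [exact: ltW|apply: le_trans f1; exact: ltW].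
by apply: lerD; apply: ler_wpM2l => //; exact: ltW.
Qed.

Lemma ctsV h x0 : cts h x0 -> h x0 != 0 -> cts (fun x => (h x)^-1) x0.
Proof.
move=> Hh n0 e e0; have p0 : 0 < `|h x0| by rewrite normr_gt0.
have q0 : 0 < `|h x0| / 2%:R by rewrite divr_gt0.
have r0 : 0 < e * (`|h x0| * (`|h x0| / 2%:R)) by apply: mulr_gt0 => //; apply: mulr_gt0.
have [m m0 [mq mr]] := common_pos q0 r0.
have [c c0 Hc] := Hh _ m0; exists c => // x /Hc Hx.
have hx : `|h x0| / 2%:R < `|h x|.
  have : `|h x0| - `|h x| < `|h x0| / 2%:R.
    apply: le_lt_trans (lerB_dist _ _) _; rewrite distrC; exact: lt_le_trans Hx mq.
  by rewrite ltrBlDr {1}(splitr `|h x0|) ltrD2l.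
have px : 0 < `|h x| by exact: lt_trans hx.
have nx : h x != 0 by rewrite -normr_gt0.
have -> : (h x)^-1 - (h x0)^-1 = (h x0 - h x) / (h x0 * h x) by field; rewrite n0 nx.
rewrite normrM normfV normrM distrC ltr_pdivrMr ?mulr_gt0 //.
apply: lt_trans (lt_le_trans Hx mr) _.
by rewrite ltr_pM2l // ltr_pM2l.
Qed.

Lemma cts_sum (J : finType) (h : J -> disc -> CC) x0 : (forall j, cts (h j) x0) ->
  cts (fun x => \sum_j h j x) x0.
Proof.
move=> H; elim: (index_enum J) => [|j s IH].
  rewrite (_ : (fun x => _) = fun _ => 0); first exact: cts_cst.
  by apply: funext => x; rewrite big_nil.
rewrite (_ : (fun x => _) = fun x => h j x + \sum_(j <- s) h j x); first exact: ctsD.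
by apply: funext => x; rewrite big_cons.
Qed.

(** Caratheodory's form of differentiability at x0, with derivative s(x0); products and quotients of
    slopes become algebra of functions continuous at x0. *)
Definition slope (h : disc -> CC) (x0 : disc) (s : disc -> CC) : Prop :=
  cts s x0 /\ forall x, h x - h x0 = (point x - point x0) * s x.

Lemma cts_point x0 : cts point x0.
Proof. by move=> e e0; exists e. Qed.

Lemma slope_cts h x0 s : slope h x0 s -> cts h x0.
Proof.
move=> [Hs E].
rewrite (_ : h = fun x => h x0 + (point x + - point x0) * s x); last first.
  by apply: funext => x; rewrite -E addrC subrK.
apply: ctsD; first exact: cts_cst.
apply: ctsM => //; apply: ctsD; [exact: cts_point|exact: cts_cst].
Qed.

Lemma CDeriv_slope (F : Complex.C -> Complex.C) (x0 : disc) l :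
  CDeriv F (proj1_sig x0) l -> exists2 s, slope (restr F) x0 s & s x0 = toCC l.
Proof.
move=> /CDerivE H.
pose s x := if point x == point x0 then toCC l else (restr F x - restr F x0) / (point x - point x0).
have s0 : s x0 = toCC l by rewrite /s eqxx.
exists s => //; split=> [e e0|x]; last first.
  rewrite /s; case: eqVneq => [/point_inj ->|n]; first by rewrite !subrr mul0r.
  by rewrite mulrC divfK // subr_eq0.
have e2 : 0 < e / 2%:R by rewrite divr_gt0.
have [r r0 Er] := pos_real e2; have [dl [dl0 Hd]] := H r r0.
exists (dl%:C%C); first by rewrite -[0]/((0 : R)%:C%C) ltcR; apply/RltP.
move=> x; rewrite s0 -toCCB toCC_norm ltcR => /RltP /Hd /RleP.
rewrite -lecR RmultE rmorphM /= -!toCC_norm !toCCB toCCM toCCB -Er => Hx.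
rewrite /s; case: eqVneq => [_|n]; first by rewrite subrr normr0.
have n0 : 0 < `|point x - point x0| by rewrite normr_gt0 subr_eq0.
have -> : (restr F x - restr F x0) / (point x - point x0) - toCC l =
   (restr F x - restr F x0 - (point x - point x0) * toCC l) / (point x - point x0).
  by field; rewrite subr_eq0.
rewrite normrM normfV ltr_pdivrMr //; apply: le_lt_trans Hx _.
by rewrite ltr_pM2r // ltr_pdivrMr // ltr_pMr // ltr1n.
Qed.

Lemma slope_CDeriv (F : Complex.C -> Complex.C) (x0 : disc) (s : disc -> CC) (d0 : CC) :
  0 < d0 -> cts s x0 ->
  (forall x, `|point x - point x0| < d0 -> restr F x - restr F x0 = (point x - point x0) * s x) ->
  CDeriv F (proj1_sig x0) (ofCC (s x0)).
Proof.
move=> d00 Hs E; apply/CDerivE => eps eps0.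
have e0 : 0 < eps%:C%C :> CC by rewrite -[0]/((0 : R)%:C%C) ltcR; apply/RltP.
have [a a0 Ha] := Hs _ e0.
(* The distance to the circle keeps the varying point in the disc, where the slope is available. *)
have r0 : 0 < (1 - Cmod (proj1_sig x0))%:C%C :> CC.
  rewrite -[0]/((0 : R)%:C%C) ltcR subr_gt0; apply/RltP; exact: (proj2_sig x0).
have [c c0 [ca cb]] := common_pos d00 a0.
have [m m0 [mc mr]] := common_pos c0 r0.
have [dl dl0 Edl] := pos_real m0.
exists dl; split=> // y /RltP; rewrite -ltcR -Edl -toCC_norm toCCB => Hy.
have Dy : Disc y.
  apply/RltP; rewrite -ltcR -toCC_norm -[toCC y](subrK (point x0)).
  apply: le_lt_trans (ler_normD _ _) _; rewrite [`|point x0|]toCC_norm.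
  have := lt_le_trans Hy mr; rewrite rmorphB /= -ltrBrDr; exact.
pose x : disc := exist _ y Dy.
have xd : `|point x - point x0| < d0 by apply: lt_le_trans ca; apply: lt_le_trans mc.
have xa : `|point x - point x0| < a by apply: lt_le_trans cb; apply: lt_le_trans mc.
apply/RleP; rewrite -lecR RmultE rmorphM /= -!toCC_norm !toCCB toCCM toCCB ofCCK.
rewrite -[toCC (F y)]/(restr F x) -[toCC (F (proj1_sig x0))]/(restr F x0) E //.
rewrite -[toCC y]/(point x) -mulrBr normrM mulrC; apply: ler_wpM2r => //.
by apply: ltW; exact: Ha.
Qed.

Section Holomorphy.
Variables (d : nat) (f g : Complex.C -> Cvec d).
Hypothesis Hf : EmbeddingMap d f.
Hypothesis Hg : EmbeddingMap d g.

Lemma emb_slope i x0 : exists s, slope (fun x => emb g x i) x0 s.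
Proof.
have [_ [_ [_ [[df [Hd _]] _]]]] := Hg.
have [s Hs _] := CDeriv_slope (Hd (proj1_sig x0) (idx i) (proj2_sig x0)).
by exists s.
Qed.

Lemma emb_regular x0 : exists i s, slope (fun x => emb f x i) x0 s /\ s x0 != 0.
Proof.
have [_ [_ [_ [[df [Hd Hn]] _]]]] := Hf.
have [j nj] := Hn _ (proj2_sig x0); have [i Ei] := idx_surj j; rewrite -Ei in nj.
have [s Hs E] := CDeriv_slope (Hd (proj1_sig x0) (idx i) (proj2_sig x0)).
exists i, s; split=> //; by rewrite E; apply/eqP => /toCC_eq0.
Qed.

Lemma emb_dist_cts x0 (e : CC) : 0 < e -> exists2 dl : CC, 0 < dl &
  forall x, `|point x - point x0| < dl -> \sum_i `|emb g x i - emb g x0 i| < e.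
Proof.
move=> e0.
have H : cts (fun x => \sum_i `|emb g x i - emb g x0 i|) x0.
  apply: cts_sum => i; have [s /slope_cts Hs] := emb_slope i x0.
  move=> r r0; have [a a0 Ha] := Hs _ r0; exists a => // x /Ha.
  by rewrite subrr normr0 subr0 normr_id.
have [dl dl0 Hd] := H _ e0; exists dl => // x /Hd.
rewrite [X in _ - X]big1 => [|i _]; last by rewrite subrr normr0.
by rewrite subr0 ger0_norm // sumr_ge0.
Qed.

Lemma mult_cts psi x0 : ismult (emb g) psi -> cts psi x0.
Proof.
move=> /(ismult_pos (embedding_dot Hg)) [M M0 HM] e e0.
have [c c0 Hc] := mult_lip (embedding_dot Hg) x0.
have cM : 0 < c * M by rewrite mulr_gt0.
have [dl dl0 Hd] := emb_dist_cts x0 (divr_gt0 e0 cM).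
exists dl => // x /Hd Hx; apply: le_lt_trans (Hc _ _ M0 HM x) _.
by rewrite mulrC -ltr_pdivlMr.
Qed.

(** Multiply the slopes of the coordinates of g by the Gleason coefficients, which are multipliers
    and hence continuous. *)
Lemma mult_slope psi x0 : ismult (emb g) psi -> exists s, slope psi x0 s.
Proof.
move=> /(ismult_pos (embedding_dot Hg)) [M M0 HM].
have [c c0 Hc] := gleason (embedding_dot Hg) x0.
have [q [E Hq]] := Hc _ _ M0 HM.
have [sg Hsg] := boolp.choice (fun i => emb_slope i x0).
exists (fun x => \sum_i sg i x * q x i); split=> [|x].
  apply: cts_sum => i; apply: ctsM; first by case: (Hsg i).
  by apply: mult_cts; exists (c * M).
rewrite E mulr_sumr; apply: eq_bigr => i _.
by have [_ ->] := Hsg i; rewrite mulrA.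
Qed.

Lemma emb_connected (P : disc -> Prop) :
  (forall x, exists2 e : CC, 0 < e &
     forall y, \sum_a `|emb g y a - emb g x a| < e -> (P y <-> P x)) ->
  forall x y, P x -> P y.
Proof.
move=> H; pose Q (z : Complex.C) := exists Dz : Disc z, P (exist _ z Dz).
have QP x : Q (proj1_sig x) <-> P x.
  case: x => z Dz; split=> [[Dz' Hz]|Hz]; last by exists Dz.
  by rewrite (Prop_irrelevance Dz Dz').
move=> x y /QP Qx; apply/QP.
apply: disc_connected Qx; [|exact: proj2_sig|exact: proj2_sig].
move=> z Dz; pose z' : disc := exist _ z Dz.
have [e e0 He] := H z'; have [dl dl0 Hd] := emb_dist_cts z' e0.
have [r r0 Er] := pos_real dl0; exists r; split=> // w Dw /RltP Hw.
pose w' : disc := exist _ w Dw.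
have /He : \sum_a `|emb g w' a - emb g z' a| < e.
  by apply: Hd; rewrite -toCCB toCC_norm Er ltcR.
by move=> PE; rewrite -[w]/(proj1_sig w') -[z]/(proj1_sig z') !QP.
Qed.

Lemma emb_proper x0 (e : CC) : 0 < e -> exists2 dl : CC, 0 < dl &
  forall x, (forall i, `|emb f x i - emb f x0 i| < dl) -> `|point x - point x0| < e.
Proof.
move=> e0; have [r r0 Er] := pos_real e0.
have [eta [eta0 H]] := @embedding_proper d f (proj1_sig x0) r Hf (proj2_sig x0) r0.
exists (eta%:C%C); first by rewrite -[0]/((0 : R)%:C%C) ltcR; apply/RltP.
move=> x Hx; rewrite -toCCB toCC_norm Er ltcR; apply/RltP.
apply: H (proj2_sig x) _ => j; have [i <-] := idx_surj j.
by apply/RltP; rewrite -ltcR -toCC_norm toCCB; exact: Hx.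
Qed.

Variable nu : disc -> disc.
Hypothesis Hnu : forall i, ismult (emb g) (fun x => emb f (nu x) i).

(** The coordinates of f o nu are multipliers, hence continuous, and properness of f transfers this
    to nu. *)
Lemma nu_cts x0 (e : CC) : 0 < e -> exists2 dl : CC, 0 < dl &
  forall x, `|point x - point x0| < dl -> `|point (nu x) - point (nu x0)| < e.
Proof.
move=> e0; have [r r0 Hr] := emb_proper (nu x0) e0.
have [dl dl0 Hd] : exists2 dl : CC, 0 < dl & forall x, `|point x - point x0| < dl ->
    forall i, `|emb f (nu x) i - emb f (nu x0) i| < r.
  have : forall s : seq 'I_d, exists2 dl : CC, 0 < dl & forall x, `|point x - point x0| < dl ->
      forall i, i \in s -> `|emb f (nu x) i - emb f (nu x0) i| < r.
    elim=> [|i s [a a0 Ha]]; first by exists 1.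
    have [b b0 Hb] := mult_cts x0 (Hnu i) r0.
    have [c c0 [ca cb]] := common_pos a0 b0; exists c => // x xc j.
    rewrite inE => /orP[/eqP ->|js]; first by apply: Hb; exact: lt_le_trans cb.
    by apply: Ha js; exact: lt_le_trans ca.
  move=> /(_ (enum 'I_d)) [a a0 Ha]; exists a => // x xa i; apply: Ha => //.
  by rewrite mem_enum.
by exists dl => // x /Hd; exact: Hr.
Qed.

(** With s the slope of f_i o nu and t a slope of f_i nonzero at nu(x0), (x - x0) s(x) = (nu(x) -
    nu(x0)) t(nu(x)). Division is possible only near x0, where t o nu does not vanish. *)
Lemma nu_slope x0 : exists s d0, [/\ 0 < d0, cts s x0 &
  forall x, `|point x - point x0| < d0 -> point (nu x) - point (nu x0) = (point x - point x0) * s x].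
Proof.
have [i [t [[Ht tE] t0]]] := emb_regular (nu x0).
have [s [Hs sE]] := mult_slope x0 (Hnu i).
have Htn : cts (fun x => t (nu x)) x0.
  move=> e e0; have [a a0 Ha] := Ht _ e0; have [b b0 Hb] := nu_cts x0 a0.
  by exists b => // x /Hb /Ha.
have tp : 0 < `|t (nu x0)| by rewrite normr_gt0.
have [d0 d00 Hd] := Htn _ tp.
exists (fun x => s x * (t (nu x))^-1), d0; split=> //.
  by apply: ctsM => //; exact: ctsV.
move=> x /Hd Hx; have tn : t (nu x) != 0.
  by apply/eqP => tx; move: Hx; rewrite tx sub0r normrN ltxx.
by rewrite mulrA -sE tE mulfK.
Qed.

Definition disc_map : Complex.C -> Complex.C :=
  fun z => if pselect (Disc z) is left H then proj1_sig (nu (exist _ z H)) else RtoC 0.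

Lemma disc_mapE (x : disc) : disc_map (proj1_sig x) = proj1_sig (nu x).
Proof.
case: x => z H; rewrite /disc_map /=; case: pselect => // H'.
by rewrite (Prop_irrelevance H' H).
Qed.

Lemma disc_map_disc z : Disc z -> Disc (disc_map z).
Proof. by move=> Dz; rewrite (disc_mapE (exist _ z Dz)); exact: proj2_sig. Qed.

Lemma disc_map_holomorphic z : Disc z -> exists l, CDeriv disc_map z l.
Proof.
move=> Dz; have [s [d0 [d00 Hs E]]] := nu_slope (exist _ z Dz).
exists (ofCC (s (exist _ z Dz))).
apply: (slope_CDeriv (x0 := exist _ z Dz) d00 Hs) => x xd.
by rewrite -E // /restr !disc_mapE.
Qed.

End Holomorphy.

(** * Algebra homomorphisms between embedded discs *)

Section Transfer.
Variables (d : nat) (f g : Complex.C -> Cvec d).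
Hypothesis Hf : EmbeddingMap d f.
Hypothesis Hg : EmbeddingMap d g.
Variable T : (disc -> CC) -> (disc -> CC).
Hypothesis HT : alg_hom (emb f) (emb g) T.

Lemma alg_hom_bounded (nu : disc -> disc) :
  (forall p, ismult (emb f) p -> T p = fun y => p (nu y)) ->
  exists2 C : R, Rlt (IZR 0) C & forall p (M : CC), mult (emb f) p M ->
    mult (emb g) (fun y => p (nu y)) (C%:C%C * M).
Proof.
have [Tm Tl Tmu T1] := HT; move=> Tnu.
have ball_f := embedding_dot Hf; have ball_g := embedding_dot Hg.
have [C C0 HC] := uniform_boundedness ball_f ball_g Tl Tm (hom_contr ball_f Tl Tmu T1).
have [c c0 Ec] := pos_real C0; exists c => // p M Hp; rewrite -Ec.
have ip : ismult (emb f) p by exists M.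
have M0 : 0 <= M by case: Hp.
(* Uniform boundedness is stated for positive bounds; a multiplier of norm 0 vanishes
   identically. *)
have [M00|Mn] := eqVneq M 0; last first.
  by rewrite -Tnu //; apply: HC => //; rewrite lt_neqAle eq_sym Mn.
rewrite M00 mulr0; have := mult_cst ball_g 0; rewrite normr0; apply: mult_ext => y.
have := mult_bound ball_f (nu y) Hp; rewrite M00 normr_le0 => /eqP.
by move=> ->.
Qed.

Lemma alg_hom_composition :
  (forall p q, ismult (emb f) p -> ismult (emb f) q -> T p = T q -> p = q) ->
  exists nu : disc -> disc, forall p, ismult (emb f) p -> T p = fun y => p (nu y).
Proof.
move=> Tinj; have [Tm Tl Tmu T1] := HT.
have D0 : Disc (RtoC 0) by rewrite /Disc Cmod_0; exact: Rlt_0_1.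
apply: hom_composition Tl Tmu T1 Tm Tinj (exist _ _ D0 : disc) _ _.
- exact: embedding_dot.
- exact: embedding_dot.
- exact: emb_connected.
- exact: embedding_separation.
Qed.

End Transfer.

(** T is composition with nu and T' composition with [ka]. The coordinates are multipliers that
    separate points, so the two maps are mutually inverse, and mu is [ka]. *)
Lemma embedding_isomorphism (d : nat) (f g : Complex.C -> Cvec d) :
  EmbeddingMap d f -> EmbeddingMap d g -> MultAlgIso (kerOf d f) (kerOf d g) ->
  exists mu : Complex.C -> Complex.C, DiscAut mu /\
    exists a b : R, [/\ Rlt (IZR 0) a, Rlt (IZR 0) b,
      (forall phi M, MultNormLe Disc (kerOf d f) phi M ->
         MultNormLe Disc (kerOf d (fun z => g (mu z))) phi (Rmult a M)) &
      (forall phi M, MultNormLe Disc (kerOf d (fun z => g (mu z))) phi M ->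
         MultNormLe Disc (kerOf d f) phi (Rmult b M))].
Proof.
move=> Hf Hg /(MultAlgIso_alg_hom Hf Hg) [T [T' [HT HT' TK T'K]]].
have ball_f := embedding_dot Hf; have ball_g := embedding_dot Hg.
have Tm p : ismult (emb f) p -> ismult (emb g) (T p) by case: HT => H _ _ _; exact: H.
have T'm p : ismult (emb g) p -> ismult (emb f) (T' p) by case: HT' => H _ _ _; exact: H.
have [|nu Hnu] := alg_hom_composition Hf Hg HT.
  by move=> p q ip iq E; rewrite -(TK p) // E TK.
have [|ka Hka] := alg_hom_composition Hg Hf HT'.
  by move=> p q ip iq E; rewrite -(T'K p) // E T'K.
have cg i := ismult_coord ball_g i; have cf i := ismult_coord ball_f i.
have nuK y : ka (nu y) = y.
  apply: (embedding_inj Hg); apply: funext => i.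
  have := congr1 (fun h => h y) (T'K _ (cg i)).
  by rewrite Hnu ?Hka //; rewrite -(Hka _ (cg i)); exact: T'm.
have kaK x : nu (ka x) = x.
  apply: (embedding_inj Hf); apply: funext => i.
  have := congr1 (fun h => h x) (TK _ (cf i)).
  by rewrite Hka ?Hnu //; rewrite -(Hnu _ (cf i)); exact: Tm.
have hnu i : ismult (emb g) (fun y => emb f (nu y) i).
  by rewrite -(Hnu _ (cf i)); exact: Tm.
have hka i : ismult (emb f) (fun x => emb g (ka x) i).
  by rewrite -(Hka _ (cg i)); exact: T'm.
exists (disc_map ka); split.
  split; first exact: disc_map_disc.
  split; first by move=> z; exact: (disc_map_holomorphic Hg Hf hka).
  exists (disc_map nu); split; first exact: disc_map_disc.
  split; first by move=> z; exact: (disc_map_holomorphic Hf Hg hnu).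
  by split=> z Dz; rewrite (disc_mapE _ (exist _ z Dz)) disc_mapE ?nuK ?kaK.
have Emu : emb (fun z => g (disc_map ka z)) = fun x => emb g (ka x).
  by apply: funext => x; rewrite /emb disc_mapE.
have ball_mu x : Disc x -> Ball d (g (disc_map ka x)).
  by move=> Dx; apply: (embedding_ball Hg); exact: disc_map_disc.
have multmu phi (M : R) : MultNormLe Disc (kerOf d (fun z => g (disc_map ka z))) phi M <->
    mult (fun x => emb g (ka x)) (restr phi) (M%:C%C).
  rewrite -Emu; apply: MultNormLeE; first exact: (emb_ball ball_mu).
  by move=> [x Dx] [y Dy]; apply: toCC_kernel; exact: ball_mu.
have [a a0 Ha] := alg_hom_bounded Hf Hg HT Hnu.
have [b b0 Hb] := alg_hom_bounded Hg Hf HT' Hka.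
exists a, b; split=> // phi M.
  (* T carries phi to phi o nu over g; pulling both back along [ka] returns phi, now over g o mu,
     without changing the bound. *)
  move=> /(embedding_mult Hf) /Ha /(mult_pull ka) H; apply/multmu.
  rewrite RmultE rmorphM /=; apply: mult_ext H => x; by rewrite kaK.
move=> /multmu /(mult_pull nu) H; apply/(embedding_mult Hf).
have H' : mult (emb g) (fun y => restr phi (nu y)) (M%:C%C).
  by move: H; rewrite (_ : (fun y => emb g (ka (nu y))) = emb g) //; apply: funext => y; rewrite nuK.
rewrite RmultE rmorphM /=; apply: mult_ext (Hb _ _ H') => x; by rewrite kaK.
Qed.

Local Close Scope sesquilinear_scope.
Local Close Scope ring_scope.
Open Scope R_scope.

Theorem theorem1p2 (d : nat) (f g : C -> Cvec d) :
  EmbeddingMap d f -> EmbeddingMap d g ->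
  MultAlgIso (kerOf d f) (kerOf d g) ->
  exists mu : C -> C, DiscAut mu /\
    (forall phi : C -> C,
       IsMult Disc (kerOf d f) phi <->
       IsMult Disc (kerOf d (fun z => g (mu z))) phi) /\
    exists a b : R, 0 < a /\ 0 < b /\
      (forall phi M, MultNormLe Disc (kerOf d f) phi M ->
         MultNormLe Disc (kerOf d (fun z => g (mu z))) phi (a * M)) /\
      (forall phi M, MultNormLe Disc (kerOf d (fun z => g (mu z))) phi M ->
         MultNormLe Disc (kerOf d f) phi (b * M)).
Proof.
intros Hf Hg HI.
destruct (embedding_isomorphism Hf Hg HI) as [mu [Hmu [a [b [Ha Hb Hab Hba]]]]].
exists mu; split; [exact Hmu | split; [| exists a, b; auto]].
intros phi; split; intros [M HM]; [exists (Rmult a M) | exists (Rmult b M)]; auto.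
Qed.
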